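(* (a) Let $\hat F$ be a probability measure on $\mathbb{R}_+$ with positive min, and let $t_0>0$. Then there is a weak solution $F$ for min-driven clustering on $[t_0,\infty)$ with $F_{t_0}=\hat F$. Moreover, the min $\ell(t)$ of $F_t$ satisfies $$\frac{\ell(t)}{\ell(t_0)}\ge\frac12\Big(\frac{t}{t_0}\Big)^{(\log2)/Q_1},\qquad t\ge t_0.$$ (b) The solution in (a) is unique on $[t_0,t_1]$ for any $t_1>t_0$. (c) Let $\hat F^{(n)}$ be a sequence of probability measures on $\mathbb{R}_+$ with positive min, and $F^{(n)}$ the weak solutions on $[t_0,\infty)$ with $F^{(n)}_{t_0}=\hat F^{(n)}$. Assume $\hat F^{(n)}\to\hat F$ weakly and that $\hat F$ has positive min, and let $F$ be the weak solution with $F_{t_0}=\hat F$. Then $F^{(n)}_t\to F_t$ weakly for every $t>t_0$.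
   Context: Fix numbers $p_k\ge 0$ ($k\ge1$) with $\sum_kp_k=1$ and $Q_1:=\sum_k kp_k<\infty$. Probability measures $F$ on $\mathbb{R}_+=[0,\infty)$ are identified with their distribution functions $F(x)=F([0,x])$; the min of $F$ is $\inf\{x:F(x)>0\}$. $C_0(\mathbb{R}_+)$ is the space of continuous functions on $\mathbb{R}_+$ tending to $0$ at infinity. For an interval $J\subset(0,\infty)$, a weak solution for min-driven clustering on $J$ is a map $t\mapsto F_t$ from $J$ to probability measures on $\mathbb{R}_+$ such that: (1) $t\mapsto\int a\,dF_t$ is measurable for each $a\in C_0(\mathbb{R}_+)$; (2) the min $\ell(t)$ of $F_t$ is positive and increasing (nondecreasing); (3) for each $a\in C_0(\mathbb{R}_+)$ and $t_0,t\in J$, $$\int a\,dF_t-\int a\,dF_{t_0}=\int_{t_0}^t\sum_{k\ge1}p_k\int_{\mathbb{R}_+^k}\Big[a\Big(\ell(s)+\sum_{i=1}^k y_i\Big)-a(\ell(s))\Big]\prod_{i=1}^kF_s(dy_i)\,\frac{ds}{Q_1 s}.$$ Weak convergence of probability measures is convergence of distribution functions at points of continuity of the limit. *)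

(* Defs.v *)
From HB Require Import structures.
From mathcomp Require Import all_boot all_order all_algebra.
From mathcomp Require Import all_classical all_reals all_analysis.
Set Implicit Arguments. Unset Strict Implicit. Unset Printing Implicit Defensive.
Import Order.TTheory GRing.Theory Num.Theory.
Import numFieldNormedType.Exports.
Local Open Scope classical_set_scope.
Local Open Scope ring_scope.

Section Defs.
Context {R : realType}.

Definition on_Rplus (P : probability R R) : Prop := P `]-oo, 0[%classic = 0%E.

Definition cdf (P : probability R R) (x : R) : R := fine (P `[0, x]%classic).

Definition minp (P : probability R R) : R := inf [set x : R | 0 < cdf P x].

Definition weak_cvg (Fn : nat -> probability R R) (F : probability R R) : Prop :=
  forall x : R, {for x, continuous (cdf F)} ->
    (fun n => cdf (Fn n) x) @ \oo --> cdf F x.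

(* C_0(R_+): continuous on [0,oo) and tending to 0 at infinity
   (values on negative reals are irrelevant) *)
Definition C0 (a : R -> R) : Prop :=
  {within `[0, +oo[, continuous a} /\ a x @[x --> +oo] --> 0.

Definition Q1 (p : nat -> R) : R := limn (fun n => \sum_(1 <= k < n) k%:R * p k).

Definition coag_weights (p : nat -> R) : Prop :=
  (forall k, (1 <= k)%N -> 0 <= p k) /\
  (fun n => \sum_(1 <= k < n) p k) @ \oo --> (1 : R) /\
  cvgn (fun n => \sum_(1 <= k < n) k%:R * p k).

(* iterated integral
   iter_int P k g = int P(dy_1) ... int P(dy_k) g(y_1 + ... + y_k),
   i.e. the integral of g(y_1+...+y_k) against the k-fold product of P *)
Fixpoint iter_int (P : probability R R) (k : nat) (g : R -> R) : R :=
  match k with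
  | 0%N => g 0
  | k'.+1 => \int[P]_(y in setT) iter_int P k' (fun s => g (y + s))
  end.

Definition coag_rate (p : nat -> R) (F : R -> probability R R) (a : R -> R)
  (s : R) : R :=
  limn (fun n => \sum_(1 <= k < n)
     p k * iter_int (F s) k (fun y => a (minp (F s) + y) - a (minp (F s)))).

Definition weak_solution (p : nat -> R) (J : set R) (F : R -> probability R R)
  : Prop :=
  (forall t, J t -> on_Rplus (F t)) /\
  (forall a, C0 a -> measurable_fun J (fun t => \int[F t]_(x in setT) a x)) /\
  (forall t, J t -> 0 < minp (F t)) /\
  (forall s t, J s -> J t -> s <= t -> minp (F s) <= minp (F t)) /\
  (forall a, C0 a -> forall s t, J s -> J t -> s <= t ->
     \int[F t]_(x in setT) a x - \int[F s]_(x in setT) a x =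
     \int[lebesgue_measure]_(u in `[s, t]%classic) (coag_rate p F a u / (Q1 p * u))).

End Defs.

(* Main.v *)
(* Write F_t(x) for the distribution function of F_t, W(t) = ln t / Q1, and
   Q(P) = sum_k p_k P^{*k}.  Mass at or below x is lost at unit rate in W-time as
   long as there is any, and gained at rate Q(F_t)(x - l(t)); so the weak
   formulation is equivalent to
     F_t(x) = max(0, F_s(x) + int_s^t Q(F_u)(x - l(u)) dW(u) - (W(t) - W(s))).
   Since all sizes are at least l0 = l(t0), the integrand below (j+1) l0 depends
   only on the values of F below j l0: induction on j gives uniqueness, and shows
   that the Picard iterates stabilise window by window.  That their limit has total
   mass 1 uses Q1 < oo.  The min doubles in one unit of W-time, because
   Q(F)(x - l) vanishes for x < 2 l; this is the growth bound.  For continuous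
   dependence, two solutions are compared, again window by window, in Levy
   distance; the gain is nonincreasing in time, which absorbs the small delays
   between their mins.  As the min is not weakly continuous, the comparison
   starts slightly after t0, when the mins of all the F^(n), n large, exceed half of
   that of the limit. *)
Require Import Defs.
From HB Require Import structures.
From mathcomp Require Import all_boot all_order all_algebra.
From mathcomp Require Import all_classical all_reals all_analysis.
From mathcomp Require Import measurable_realfun ring lra.
Set Implicit Arguments. Unset Strict Implicit. Unset Printing Implicit Defensive.
Import Order.TTheory GRing.Theory Num.Theory.
Import numFieldNormedType.Exports.
Local Open Scope classical_set_scope.
Local Open Scope ring_scope.

(** * Distribution functions and integrals *)

(** Monotonicity does the work of continuity in time. The loss rate at [x] is the indicator of
    [minp (F u) <= x], which is discontinuous in [F]; writing the equation with a positive part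
    removes it and leaves only the gain, which is monotone in the distribution function. As [F_u(x)]
    is nonincreasing in [u], so is the gain: it is measurable in time, and on a time interval it is
    bounded by its values at the two ends. The second tool is [fp_vanish], which turns a small mass
    below a level into a short time until that mass is gone. It recovers the indicator from the
    positive part, bounds the delay between the mins of two solutions, and clears the small mass
    that approximating data may have below half the limiting min. Since the Picard iterates
    stabilise below every level, the only danger in the limit is mass escaping to infinity. It is
    excluded on short time steps, where the deficit is at most about half of itself. *)

Section dist.
Context {R : realType}.
Implicit Types (P : probability R R) (x : R).

(** Half-lines rather than the [[0, x]] of [cdf]: they generate the Borel sets of the line and match
    Lebesgue-Stieltjes measures. The two functions agree once the negative half-line is null. *)
Definition dist P x : R := fine (P `]-oo, x]%classic).

Lemma EFin_dist P x : (dist P x)%:E = P `]-oo, x]%classic.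
Proof. by rewrite fineK// fin_num_measure. Qed.

Lemma dist_ge0 P x : 0 <= dist P x.
Proof. exact: fine_ge0. Qed.

Lemma dist_le0 P x : dist P x <= 0 -> dist P x = 0.
Proof. by move=> h; apply/eqP; rewrite eq_le h dist_ge0. Qed.

Lemma dist_le1 P x : dist P x <= 1.
Proof. by rewrite -lee_fin EFin_dist probability_le1. Qed.

Lemma le_dist P x y : x <= y -> dist P x <= dist P y.
Proof.
move=> xy; rewrite -lee_fin !EFin_dist le_measure ?inE//.
by apply: subset_itvl; rewrite bnd_simp.
Qed.

Lemma dist_right_cvg P x : dist P (x + n.+1%:R^-1) @[n --> \oo] --> dist P x.
Proof.
apply: fine_cvg; rewrite EFin_dist.
have -> : `]-oo, x]%classic = \bigcap_n `]-oo, x + n.+1%:R^-1]%classic.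
  exact: itvNycEbigcap.
apply: nonincreasing_cvg_mu => [|? |//|m n mn].
- by rewrite -ge0_fin_numE// fin_num_measure.
- exact: measurable_itv.
- exact: bigcap_measurable.
- by apply/subsetPset/subset_itvl; rewrite bnd_simp lerD2l lef_pV2 ?posrE// ler_nat.
Qed.

Lemma dist_right P x e : 0 < e -> exists2 d, 0 < d & dist P (x + d) < dist P x + e.
Proof.
move=> e0; have /cvgrPdist_lt /(_ _ e0)[n _ /(_ n (leqnn n))] := @dist_right_cvg P x.
move=> h; exists n.+1%:R^-1; first by rewrite invr_gt0.
have := ler_norm (dist P (x + n.+1%:R^-1) - dist P x); rewrite distrC; lra.
Qed.

Lemma dist_cvg1 P e : 0 < e -> exists2 x, 0 < x & 1 - e < dist P x.
Proof.
move=> e0.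
have c : dist P n%:R @[n --> \oo] --> (1 : R).
  apply: fine_cvg; rewrite -(probability_setT P).
  have <- : \bigcup_n `]-oo, n%:R : R]%classic = setT.
    rewrite -subTset => t _/=.
    by exists (Num.truncn t).+1; rewrite //= in_itv/= ltW// truncnS_gt.
  apply: nondecreasing_cvg_mu => [?|//|m n mn].
  - exact: measurable_itv.
  - exact: bigcup_measurable.
  - by apply/subsetPset/subset_itvl; rewrite bnd_simp ler_nat.
move/cvgrPdist_lt : c => /(_ _ e0)[n _ /(_ n.+1 (leqnSn n))] /= h.
exists n.+1%:R => //; have := ler_norm (1 - dist P n.+1%:R); lra.
Qed.

(** The half-lines are stable under intersection and generate the Borel sets, so uniqueness of
    measures applies. *)
Lemma dist_inj P Q : dist P =1 dist Q -> forall A, measurable A -> P A = Q A.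
Proof.
move=> PQ A mA.
pose G : set (set R) := [set B | exists x, B = `]-oo, x]%classic].
have sG : @measurable _ R = <<s G >>.
  apply/seteqP; split; apply: smallest_sub => //; try exact: smallest_sigma_algebra.
    move=> _ [[a b] _ <-] /=.
    have -> : `]a, b]%classic = `]-oo, b] `\` `]-oo, a].
      by rewrite -[RHS]setCK setCD setCitvl setUC -[LHS]setCK setCitv.
    have sGx (y : R) : <<s G >> `]-oo, y]%classic.
      by apply: sub_sigma_algebra; exists y.
    exact: (@measurableD _ (g_sigma_algebraType G) _ _ (sGx b) (sGx a)).
  by move=> _ [x ->]; exact: (@measurable_itv R).
apply: (@measure_unique _ _ _ G (fun n => `]-oo, n%:R]%classic)) => //.
- move=> _ _ [x ->] [y ->]; exists (Num.min x y).
  by apply/seteqP; split => z /=; rewrite !in_itv/= le_min => /andP.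
- by move=> n; exists n%:R.
- rewrite -subTset => t _/=.
  by exists (Num.truncn t).+1; rewrite //= in_itv/= ltW// truncnS_gt.
- by move=> _ [x ->] /=; rewrite -[LHS]EFin_dist -[RHS]EFin_dist PQ.
- by move=> n; rewrite /= -ge0_fin_numE// fin_num_measure.
Qed.

(** The Lebesgue-Stieltjes measure of [c]. Right continuity is asked along one sequence and the
    limit 1 at single points, the form in which convergence theorems deliver them; monotonicity
    upgrades both. *)
Lemma exists_prob (c : R -> R) : {homo c : x y / x <= y} ->
  (forall x, c (x + n.+1%:R^-1) @[n --> \oo] --> c x) ->
  (forall x, x < 0 -> c x = 0) -> (forall x, c x <= 1) ->
  (forall e, 0 < e -> exists x, 1 - e < c x) ->
  exists P, dist P =1 c.
Proof.
move=> cnd cright c0 c1 clim.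
have crc : right_continuous c.
  move=> x; apply/cvgrPdist_lt => e e0.
  have /cvgrPdist_lt /(_ _ e0)[n _ /(_ n (leqnn n)) h] := cright x.
  near=> y.
  have xy : x < y by near: y; exact: nbhs_right_gt.
  have yd : y <= x + n.+1%:R^-1.
    by near: y; apply: nbhs_right_le; rewrite ltrDl invr_gt0.
  have h1 := cnd _ _ (ltW xy); have h2 := cnd _ _ yd; move: h => /=.
  by rewrite ler0_norm ?ler0_norm; lra.
have cN : c @ -oo --> (0 : R).
  apply/cvgrPdist_lt => e e0; near=> x.
  by rewrite c0 ?subrr ?normr0//; near: x; apply: nbhs_ninfty_lt; exact: num_real.
have cy : c @ +oo --> (1 : R).
  apply/cvgrPdist_lt => e e0; have [x xe] := clim _ e0; near=> y.
  have xy : x <= y by near: y; apply: nbhs_pinfty_ge; exact: num_real.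
  have := cnd _ _ xy; have := c1 y => ? ?; rewrite ger0_norm; lra.
pose C1 := isCumulative.Build R _ R c cnd crc.
pose C2 := isCumulativeBounded.Build R 0 1 c cN cy.
pose f : cumulativeBounded (0:R) (1:R) := HB.pack c C1 C2.
pose id1 : measurableTypeR R -> R := idfun.
pose M1 := @isMeasurableFun.Build _ _ _ _ id1 (@measurable_id _ _ setT).
pose X : {mfun measurableTypeR R >-> R} := HB.pack id1 M1.
exists (distribution (lebesgue_stieltjes_measure f) X : probability R R) => x.
exact: (congr1 fine (cdf_lebesgue_stieltjes_id f x)).
Unshelve. all: by end_near. Qed.

End dist.

(** * Comparison of integrals of functions that may fail to be measurable *)

Section raw_integral.
Context d (T : measurableType d) (R : realType) (mu : {measure set T -> \bar R}).
Local Open Scope ereal_scope.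
Import HBNNSimple.

(** The integral of a nonnegative function is a supremum over the simple functions below it, hence
    monotone for arbitrary functions. Test functions of [C0] are arbitrary on the negative reals,
    and some rates are bounded without a proof that they are measurable in time. *)
Lemma ge0_le_integral_nomeas D (f g : T -> \bar R) :
  (forall x, D x -> 0 <= f x) -> (forall x, D x -> f x <= g x) ->
  \int[mu]_(x in D) f x <= \int[mu]_(x in D) g x.
Proof.
move=> f0 fg.
have g0 x : D x -> 0 <= g x by move=> Dx; exact: le_trans (f0 _ Dx) (fg _ Dx).
rewrite !ge0_integralE// ge_ereal_sup// => _ [h/= hf <-].
apply: ereal_sup_ubound; exists h => //= x; apply: le_trans (hf x) _.
by rewrite /patch; case: ifPn => //; rewrite inE; exact: fg.
Qed.

(** A simple function below [f] is measurable, so it may be cut to [A]; the supremum inherits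
    this. *)
Lemma ge0_integral_null_setC (A : set T) (f : T -> \bar R) : measurable A ->
  mu (~` A) = 0 -> (forall x, 0 <= f x) ->
  \int[mu]_x f x = \int[mu]_(x in A) f x.
Proof.
move=> mA A0 f0; apply/eqP; rewrite eq_le; apply/andP; split; last first.
  rewrite integral_mkcond; apply: ge0_le_integral_nomeas => x _;
    by rewrite /patch; case: ifPn.
rewrite ge0_integralTE// ge_ereal_sup// => _ [h/= hf <-].
rewrite -integralT_nnsfun (@ge0_negligible_integral _ _ _ mu setT (~` A))//.
- rewrite setTD setCK; apply: ge0_le_integral_nomeas => x _; last exact: hf.
  by rewrite lee_fin.
- exact: measurableC.
- by apply/measurable_EFinP; exact: measurable_funPT.
- by move=> x _; rewrite lee_fin.
Qed.

Lemma integral_null_setC (A : set T) (f : T -> \bar R) : measurable A ->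
  mu (~` A) = 0 -> \int[mu]_x f x = \int[mu]_(x in A) f x.
Proof.
move=> mA A0; rewrite integralE [RHS]integralE.
by congr (_ - _); apply: ge0_integral_null_setC.
Qed.

Lemma integral_fin_bound D (f : T -> \bar R) (M : R) : measurable D ->
  mu D < +oo -> (forall x, D x -> 0 <= f x <= M%:E) ->
  \int[mu]_(x in D) f x \is a fin_num.
Proof.
move=> mD Doo fM; rewrite ge0_fin_numE; last first.
  by apply: integral_ge0 => x /fM/andP[].
apply: (@le_lt_trans _ _ (\int[mu]_(x in D) (cst M%:E x))).
  by apply: ge0_le_integral_nomeas => x /fM/andP[].
by rewrite integral_cst// ltey_eq fin_numM// ge0_fin_numE.
Qed.

(** The common bound [M] keeps the integrals of positive and negative parts finite; an infinite one
    could be sent to 0 by [fine] and break the inequality. *)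
Lemma le_Rintegral_nomeas D (f g : T -> R) (M : R) : measurable D ->
  mu D < +oo -> (forall x, D x -> `|f x| <= M)%R ->
  (forall x, D x -> `|g x| <= M)%R -> (forall x, D x -> f x <= g x)%R ->
  (\int[mu]_(x in D) f x <= \int[mu]_(x in D) g x)%R.
Proof.
move=> mD Doo fM gM fg; rewrite /Rintegral.
have bnd (k : T -> R) : (forall x, D x -> `|k x| <= M)%R ->
    forall x, D x -> (0 <= (EFin \o k)^\+ x <= M%:E) /\ (0 <= (EFin \o k)^\- x <= M%:E).
  move=> kM x /kM; rewrite ler_norml => /andP[k1 k2].
  rewrite !funeposE !funenegE /= -?EFinN -!EFin_max !lee_fin !ge_max !le_max lexx !orbT/=.
  by split; lra.
have fin k : (forall x, D x -> `|k x| <= M)%R ->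
    (\int[mu]_(x in D) (EFin \o k)^\+ x \is a fin_num) /\
    (\int[mu]_(x in D) (EFin \o k)^\- x \is a fin_num).
  move=> kM; split; apply: (@integral_fin_bound _ _ M) => // x Dx;
    by have [] := bnd _ kM _ Dx.
have [f1 f2] := fin _ fM; have [g1 g2] := fin _ gM.
rewrite [X in (fine X <= _)%R]integralE [X in (_ <= fine X)%R]integralE.
have aux (u v w z : \bar R) : u \is a fin_num -> v \is a fin_num ->
    w \is a fin_num -> z \is a fin_num -> u <= w -> z <= v ->
    (fine (u - v) <= fine (w - z))%R.
  by case: u v w z => [u| |] [v| |] [w| |] [z| |]//= _ _ _ _; exact: lerB.
apply: aux => //; apply: ge0_le_integral_nomeas => // x Dx; have := fg _ Dx;
  rewrite ?funeposE ?funenegE /= -?EFinN -!EFin_max lee_fin ge_max !le_max lexx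
    orbT => ?; lra.
Qed.

End raw_integral.

Lemma eq_cvgn (R : realType) (u v : nat -> R) (l : R) : u =1 v ->
  u @ \oo --> l -> v @ \oo --> l.
Proof. by move=> /funext ->. Qed.

Section bounded_integral.
Context d (T : measurableType d) (R : realType) (mu : {measure set T -> \bar R}).
Variables (D : set T) (mD : measurable D) (Doo : (mu D < +oo)%E).

Lemma bounded_integrable (g : T -> R) (M : R) : measurable_fun D g ->
  (forall x, D x -> `|g x| <= M) -> mu.-integrable D (EFin \o g).
Proof.
move=> mg gM; apply: measurable_bounded_integrable => //.
by exists M; split; [exact: num_real|move=> y My x /= /gM/le_trans; apply; exact: ltW].
Qed.

Lemma bounded_cvg_Rintegral (g_ : nat -> T -> R) (g : T -> R) (M : R) :
  (forall n, measurable_fun D (g_ n)) ->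
  (forall n x, D x -> `|g_ n x| <= M) ->
  (forall x, D x -> g_ n x @[n --> \oo] --> g x) ->
  \int[mu]_(x in D) g_ n x @[n --> \oo] --> \int[mu]_(x in D) g x.
Proof.
move=> mg gM gg.
have mgl : measurable_fun D g by exact: (measurable_fun_cvg mg).
have gMl x : D x -> `|g x| <= M.
  move=> Dx; have c : `|g_ n x| @[n --> \oo] --> `|g x|.
    by apply: cvg_norm; exact: gg.
  rewrite -(cvg_lim _ c)//.
  apply: limr_le; first by apply/cvg_ex; eexists; exact: c.
  by near=> n; exact: gM.
apply: fine_cvg; rewrite -/(Rintegral _ _ _).
rewrite fineK; last first.
  by apply: integrable_fin_num => //; exact: (bounded_integrable mgl gMl).
have [] // := @dominated_convergence _ _ _ mu D mD (fun n => EFin \o g_ n)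
  (EFin \o g) (cst M%:E).
- by move=> n; apply/measurable_EFinP.
- exact/measurable_EFinP.
- by apply: aeW => x Dx /=; apply: cvg_EFin; [exact: nearW|exact: gg].
- apply: (@bounded_integrable (cst M) `|M|) => //=.
- by apply: aeW => x n Dx; rewrite lee_fin gM.
Unshelve. all: by end_near. Qed.

End bounded_integral.

Definition bmeas d (T : measurableType d) (R : realType) (g : T -> R) :=
  measurable_fun setT g /\ exists M : R, forall x, `|g x| <= M.

Section probability_integral.
Context d (T : measurableType d) (R : realType) (P : probability T R).
Implicit Types f g : T -> R.

Let PTy : (P setT < +oo)%E. Proof. by rewrite probability_setT ltry. Qed.

Lemma bmeas_integrable g : bmeas g -> P.-integrable setT (EFin \o g).
Proof. by move=> [mg [M gM]]; apply: (bounded_integrable _ PTy mg). Qed.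

Lemma EFin_Rintegral g : bmeas g ->
  (\int[P]_(x in setT) g x)%:E = (\int[P]_x (g x)%:E)%E.
Proof.
by move=> bg; rewrite fineK//; apply: integrable_fin_num => //; exact: bmeas_integrable.
Qed.

Lemma Rintegral_prob_cst (k : R) : \int[P]_(x in setT) k = k.
Proof. rewrite Rintegral_cst//. by rewrite [X in fine X](probability_setT P) mulr1. Qed.

Lemma le_Rintegral_prob f g (M : R) : (forall x, `|f x| <= M) ->
  (forall x, `|g x| <= M) -> (forall x, f x <= g x) ->
  \int[P]_(x in setT) f x <= \int[P]_(x in setT) g x.
Proof. by move=> fM gM fg; apply: (@le_Rintegral_nomeas _ _ _ _ _ _ _ M). Qed.

Lemma Rintegral_prob_le g (M : R) : (forall x, `|g x| <= M) ->
  `|\int[P]_(x in setT) g x| <= M.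
Proof.
move=> gM; have bnd x : - M <= g x <= M by rewrite -ler_norml.
have M0 : 0 <= M by exact: le_trans (gM point).
rewrite ler_norml; apply/andP; split.
  rewrite -[leLHS]Rintegral_prob_cst; apply: (@le_Rintegral_prob _ _ M) => //.
    by move=> x; rewrite normrN ger0_norm.
  by move=> x; have /andP[] := bnd x.
rewrite -[leRHS]Rintegral_prob_cst; apply: (@le_Rintegral_prob _ _ M) => //.
  by move=> x; rewrite ger0_norm.
by move=> x; have /andP[] := bnd x.
Qed.

Lemma RintegralB_prob f g : bmeas f -> bmeas g ->
  \int[P]_(x in setT) (f x - g x) =
  \int[P]_(x in setT) f x - \int[P]_(x in setT) g x.
Proof. by move=> bf bg; apply: RintegralB => //; exact: bmeas_integrable. Qed.

Lemma cvg_Rintegral_prob (g_ : nat -> T -> R) g (M : R) :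
  (forall n, measurable_fun setT (g_ n)) -> (forall n x, `|g_ n x| <= M) ->
  (forall x, g_ n x @[n --> \oo] --> g x) ->
  \int[P]_(x in setT) g_ n x @[n --> \oo] --> \int[P]_(x in setT) g x.
Proof. by move=> mg gM gg; apply: (@bounded_cvg_Rintegral _ _ _ _ _ _ PTy _ _ M). Qed.

End probability_integral.

(** * Convolution powers and their mixture *)

Section convolution.
Context {R : realType}.
Implicit Types (P Q : probability R R) (g : R -> R).

Definition addRR (z : R * R) : R := z.1 + z.2.

Lemma measurable_addRR : measurable_fun setT addRR.
Proof. by apply: measurable_funD. Qed.

HB.instance Definition _ := isMeasurableFun.Build _ _ _ _ addRR measurable_addRR.

Definition conv P Q : probability R R :=
  distribution (P \x Q : probability (R * R)%type R)%E addRR.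

Lemma conv_integral P Q g : bmeas g ->
  \int[conv P Q]_(z in setT) g z =
  \int[P]_(x in setT) \int[Q]_(y in setT) g (x + y).
Proof.
move=> [mg [M gM]].
have mgD : measurable_fun setT (g \o addRR).
  by apply: measurableT_comp => //; exact: measurable_addRR.
have igD : (P \x Q)%E.-integrable setT (EFin \o (g \o addRR)).
  by apply: (@bmeas_integrable _ _ _ (P \x Q)%E); split => //; exists M => x; exact: gM.
apply/EFin_inj; rewrite EFin_Rintegral//; last by split => //; exists M.
have mgE : measurable_fun setT (EFin \o g) by exact/measurable_EFinP.
rewrite [LHS](@integral_pushforward _ _ _ _ _ _ measurable_addRR (P \x Q)%E
  setT _ mgE)//.
rewrite preimage_setT -(@integral12_prod_meas1 _ _ _ _ _ P Q _ igD).
rewrite EFin_Rintegral; last first.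
  split; last by exists M => x; apply: Rintegral_prob_le => y.
  apply/measurable_EFinP; apply: eq_measurable_fun (measurable_fubini_F igD) => x _.
  rewrite /fubini_F /= EFin_Rintegral//; split; last by exists M.
  by apply: measurableT_comp => //; exact: measurable_funD.
apply: eq_integral => x _; rewrite EFin_Rintegral//; split; last by exists M.
by apply: measurableT_comp => //; exact: measurable_funD.
Qed.

End convolution.

Section convolution_dist.
Context {R : realType}.
Implicit Types (P Q : probability R R) (g : R -> R).

Definition below (x y : R) : R := (y <= x)%R%:R.

Lemma below_bound x y : `|below x y| <= 1.
Proof. by rewrite /below normr_nat lern1 leq_b1. Qed.

Lemma below1 x y : y <= x -> below x y = 1.
Proof. by rewrite /below => ->. Qed.

Lemma below0 x y : x < y -> below x y = 0.
Proof. by rewrite /below ltNge => /negbTE ->. Qed.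

Lemma bmeas_below x : bmeas (below x).
Proof.
split; last by exists 1; exact: below_bound.
have -> : below x = \1_(`]-oo, x]%classic).
  apply/funext => y; rewrite /below indicE; congr ((nat_of_bool _)%:R).
  by apply/idP/idP; rewrite inE/= in_itv.
exact: measurable_indic.
Qed.

Lemma dist_Rintegral P x : dist P x = \int[P]_(y in setT) below x y.
Proof.
rewrite /dist /Rintegral; congr fine.
rewrite -[in LHS](setIT `]-oo, x]%classic) -integral_indic//.
apply: eq_integral => y _; rewrite /below indicE; congr ((nat_of_bool _)%:R%:E).
by apply/idP/idP; rewrite inE/= in_itv.
Qed.

Lemma dist_conv P Q x : dist (conv P Q) x = \int[P]_(y in setT) dist Q (x - y).
Proof.
rewrite dist_Rintegral conv_integral; last exact: bmeas_below.
apply: eq_Rintegral => y _; rewrite dist_Rintegral.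
by apply: eq_Rintegral => z _; rewrite /below lerBrDl.
Qed.

Lemma bmeas_dist Q (x : R) : bmeas (fun y : R => dist Q (x - y)).
Proof.
split; last by exists 1 => y; rewrite ger0_norm ?dist_ge0 ?dist_le1.
by apply: nonincreasing_measurable => // y z yz; apply: le_dist; lra.
Qed.

(** Tonelli for the indicator of [z.1 + z.2 <= x]. *)
Lemma dist_convC P Q x : dist (conv P Q) x = dist (conv Q P) x.
Proof.
have mh : measurable_fun setT (fun z : R * R => (below x (z.1 + z.2))%:E).
  apply/measurable_EFinP; apply: measurableT_comp; first by case: (bmeas_below x).
  exact: measurable_funD.
have := @fubini_tonelli _ _ _ _ _ P Q (fun z => (below x (z.1 + z.2))%:E) mh.
move=> h; rewrite !dist_conv /Rintegral; congr fine.
transitivity (\int[P]_y \int[Q]_z (below x (y + z))%:E)%E.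
  apply: eq_integral => y _; rewrite dist_Rintegral EFin_Rintegral; last exact: bmeas_below.
  by apply: eq_integral => z _; rewrite /below lerBrDl.
rewrite h; last by move=> z; rewrite lee_fin ler0n.
apply: eq_integral => y _; rewrite dist_Rintegral EFin_Rintegral; last exact: bmeas_below.
by apply: eq_integral => z _; rewrite /below lerBrDr.
Qed.

Definition supp_ge (c : R) P := forall x, x < c -> dist P x = 0.

Lemma supp_geW c c' P : c' <= c -> supp_ge c P -> supp_ge c' P.
Proof. by move=> cc' h x xc; apply: h; exact: lt_le_trans cc'. Qed.

Lemma dist_left_cvg P c :
  dist P (c - n.+1%:R^-1) @[n --> \oo] --> fine (P `]-oo, c[%classic).
Proof.
apply: fine_cvg; rewrite fineK ?fin_num_measure//.
have -> : `]-oo, c[%classic = \bigcup_n `]-oo, c - n.+1%:R^-1]%classic.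
  apply/seteqP; split => t /=; last first.
    move=> [n _] /=; rewrite !in_itv/= => /le_lt_trans; apply.
    by rewrite ltrBlDr ltrDl invr_gt0.
  rewrite in_itv/= => tc; exists (Num.truncn (c - t)^-1) => //=.
  rewrite in_itv/= lerBrDl -lerBrDr -[leRHS]invrK lef_pV2 ?posrE ?invr_gt0 ?subr_gt0//.
  exact/ltW/truncnS_gt.
apply: nondecreasing_cvg_mu => [?|//|m n mn].
- exact: measurable_itv.
- exact: bigcup_measurable.
- by apply/subsetPset/subset_itvl; rewrite bnd_simp lerB// lef_pV2 ?posrE// ler_nat.
Qed.

Lemma supp_ge_null c P : supp_ge c P -> P (~` `[c, +oo[%classic) = 0%E.
Proof.
move=> h; rewrite setCitvr.
have c0 : dist P (c - n.+1%:R^-1) @[n --> \oo] --> (0 : R).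
  apply: (@eq_cvgn _ (cst 0)); last exact: cvg_cst.
  by move=> n; rewrite h// ltrBlDr ltrDl invr_gt0.
have e0 := cvg_unique _ (@dist_left_cvg P c) c0.
by rewrite -[LHS]fineK ?fin_num_measure// [X in X%:E]e0.
Qed.

Lemma eq_Rintegral_supp c P f g : supp_ge c P -> (forall u, c <= u -> f u = g u) ->
  \int[P]_(u in setT) f u = \int[P]_(u in setT) g u.
Proof.
move=> /supp_ge_null cP fg; rewrite /Rintegral.
rewrite !(@integral_null_setC _ _ _ P `[c, +oo[%classic)//.
congr fine; apply: eq_integral => u; rewrite inE/= in_itv/= andbT => cu.
by rewrite fg.
Qed.

Lemma le_Rintegral_supp c P f g (M : R) : supp_ge c P ->
  (forall x, `|f x| <= M) -> (forall x, `|g x| <= M) ->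
  (forall u, c <= u -> f u <= g u) ->
  \int[P]_(u in setT) f u <= \int[P]_(u in setT) g u.
Proof.
move=> cP fM gM fg.
(* Capping [f] by [g] changes it only off the support and makes the inequality hold everywhere. *)
rewrite (@eq_Rintegral_supp c P f (fun u => Num.min (f u) (g u)))//; last first.
  by move=> u /fg fgu; rewrite min_l.
apply: (@le_Rintegral_prob _ _ _ _ _ _ M) => // x; last by rewrite ge_min lexx orbT.
by rewrite /Num.min; case: ifP.
Qed.

(* The one-sided Levy-type comparison passes to convolutions: the second factor
   is compared first, and the first one after exchanging the integrations. *)
Lemma le_dist_conv P P' Q Q' (c k x y z e e' : R) :
  supp_ge c P -> supp_ge k Q' ->
  (forall u, c <= u -> dist Q (x - u) <= dist Q' (y - u) + e) ->
  (forall u, k <= u -> dist P (y - u) <= dist P' (z - u) + e') ->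
  dist (conv P Q) x <= dist (conv P' Q') z + (e + e').
Proof.
move=> cP kQ h1 h2.
have step (S S1 S2 : probability R R) (b v w r : R) : supp_ge b S ->
    (forall u, b <= u -> dist S1 (v - u) <= dist S2 (w - u) + r) ->
    dist (conv S S1) v <= dist (conv S S2) w + r.
  move=> bS h; rewrite !dist_conv -[X in _ + X](Rintegral_prob_cst S).
  rewrite -RintegralD//; last 2 first.
    by apply: bmeas_integrable; exact: bmeas_dist.
    by apply: bmeas_integrable; split => //; exists `|r|.
  apply: (@le_Rintegral_supp b _ _ _ (1 + `|r|)) => // u.
    by rewrite ger0_norm ?dist_ge0// (le_trans (dist_le1 _ _))// lerDl.
  by rewrite (le_trans (ler_normD _ _))// lerD2r ger0_norm ?dist_ge0 ?dist_le1.
have := step _ _ _ _ _ _ _ cP h1; have := step _ _ _ _ _ _ _ kQ h2.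
rewrite (dist_convC Q' P) (dist_convC Q' P'); lra.
Qed.

Lemma dirac_Rintegral (r : R) g : bmeas g -> \int[dirac r]_(y in setT) g y = g r.
Proof.
move=> [mg _]; rewrite /Rintegral integral_dirac//; last exact/measurable_EFinP.
by rewrite [X in (X * _)%E]diracT mul1e.
Qed.

Fixpoint convn P k : probability R R :=
  if k is k'.+1 then conv P (convn P k') else dirac (0 : R).

Lemma convnS P k : convn P k.+1 = conv P (convn P k). Proof. by []. Qed.

Lemma dist_dirac0 x : dist (dirac (0 : R)) x = (0 <= x)%R%:R.
Proof.
rewrite /dist [X in fine X]diracE/=; congr ((nat_of_bool _)%:R).
by apply/idP/idP; rewrite inE/= in_itv.
Qed.

Lemma dist_convn0 P x : dist (convn P 0) x = (0 <= x)%R%:R.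
Proof. exact: dist_dirac0. Qed.

Lemma supp_ge_conv b c P Q : supp_ge b P -> supp_ge c Q -> supp_ge (b + c) (conv P Q).
Proof.
move=> bP cQ x xbc; rewrite dist_conv.
rewrite (@eq_Rintegral_supp b P _ (fun=> 0))// ?Rintegral_prob_cst// => u bu.
by apply: cQ; lra.
Qed.

Lemma supp_ge_convn c P k : supp_ge c P -> supp_ge (k%:R * c) (convn P k).
Proof.
move=> cP; elim: k => [|k IH]; first by rewrite mul0r => x x0; rewrite dist_convn0 leNgt x0.
by rewrite -natr1 mulrDl mul1r addrC; exact: supp_ge_conv.
Qed.

Lemma bmeas_shift g (s : R) : bmeas g -> bmeas (fun y : R => g (s + y)).
Proof.
move=> [mg [M gM]]; split; last by exists M.
by apply: measurableT_comp => //; exact: measurable_funD.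
Qed.

Lemma iter_int_convn P k g : bmeas g ->
  iter_int P k g = \int[convn P k]_(y in setT) g y.
Proof.
elim: k g => [|k IH] g bg /=.
  by rewrite dirac_Rintegral.
rewrite conv_integral//; apply: eq_Rintegral => y _.
by rewrite IH//; exact: bmeas_shift.
Qed.

(** Allows a function of [C0], unconstrained on the negative reals, to be exchanged for a bounded
    measurable one, to which [iter_int_convn] applies. *)
Lemma eq_iter_int P k g g' : supp_ge 0 P -> (forall y, 0 <= y -> g y = g' y) ->
  iter_int P k g = iter_int P k g'.
Proof.
move=> P0; elim: k g g' => [|k IH] g g' gg' /=; first exact: gg'.
apply: eq_Rintegral_supp P0 _ => u u0; apply: IH => y y0.
by apply: gg'; exact: addr_ge0.
Qed.

End convolution_dist.

Arguments supp_ge_convn {R c P} k _.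

(** * The mixture of the convolution powers *)

Section mixture.
Context {R : realType}.
Variables (p : nat -> R) (hp : coag_weights p).
Implicit Types (P Q : probability R R) (g : R -> R).

(** [p 0] is unconstrained, hence the value 0 there. The absolute value, which changes nothing for
    [k >= 1], makes the weights nonnegative by construction, as scaling a measure demands. *)
Definition wt k : R := if k is 0%N then 0 else `|p k|.

Lemma wt_ge0 k : 0 <= wt k. Proof. by case: k => //= k. Qed.

Definition wtn k : {nonneg R} := NngNum (wt_ge0 k).

Let p_ge0 k : 0 <= p k.+1. Proof. by have [h _] := hp; exact: h. Qed.

Lemma sum_wt n (f : nat -> R) :
  \sum_(0 <= k < n) wt k * f k = \sum_(1 <= k < n) p k * f k.
Proof.
case: n => [|n]; first by rewrite !big_geq.
rewrite big_nat_recl// mul0r add0r [RHS]big_add1/=.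
by apply: eq_bigr => k _; rewrite ger0_norm.
Qed.

Definition mixture_measure P : set R -> \bar R :=
  mseries (fun k => mscale (wtn k) (convn P k)) 0.

HB.instance Definition _ P := Measure.on (mixture_measure P).

Lemma ge0_mixture_integral P g : bmeas g -> (forall x, 0 <= g x) ->
  (\int[mixture_measure P]_x (g x)%:E =
   \sum_(k <oo) (wt k * \int[convn P k]_(y in setT) g y)%:E)%E.
Proof.
move=> bg g0; have mg : measurable_fun setT (EFin \o g).
  by apply/measurable_EFinP; case: bg.
rewrite ge0_integral_measure_series//; last by move=> x _; rewrite lee_fin.
apply: eq_eseriesr => k _; rewrite ge0_integral_mscale//; last by move=> x _; rewrite lee_fin.
by rewrite EFinM EFin_Rintegral.
Qed.

Lemma mixture_measureT P : mixture_measure P setT = 1%E.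
Proof.
have <- : (\int[mixture_measure P]_x (cst 1%:E x) = mixture_measure P setT)%E.
  by rewrite integral_cst// mul1e.
rewrite (ge0_mixture_integral P (g := cst 1))//; last first.
  by split => //; exists 1 => x; rewrite normr1.
apply/cvg_lim => //.
have [_ [h _]] := hp.
have -> : (fun n => \sum_(0 <= k < n) (wt k * \int[convn P k]_(y in setT) cst 1 y)%:E)%E
   = EFin \o (fun n => \sum_(1 <= k < n) p k).
  apply/funext => n /=; rewrite sumEFin sum_wt; congr EFin.
  by apply: eq_bigr => k _; rewrite Rintegral_prob_cst mulr1.
by apply: cvg_EFin; [exact: nearW|exact: h].
Qed.

HB.instance Definition _ P :=
  Measure_isProbability.Build _ _ _ (mixture_measure P) (mixture_measureT P).

Definition mixture P : probability R R := mixture_measure P.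

Lemma cvg_mixture_integral P g : bmeas g ->
  \sum_(1 <= k < n) p k * \int[convn P k]_(y in setT) g y @[n --> \oo] -->
  \int[mixture P]_(y in setT) g y.
Proof.
move=> bg; have [mg [M gM]] := bg.
have M0 : 0 <= M by exact: le_trans (gM 0).
(* Adding [M] makes the integrand nonnegative, as integration against a series of measures requires;
   the total weight 1 lets [M] be subtracted again. *)
have bgM : bmeas (fun x => g x + M).
  split; first exact: measurable_funD.
  by exists (M + M) => x; rewrite (le_trans (ler_normD _ _))// lerD// ger0_norm.
have gM0 x : 0 <= g x + M by have := gM x; rewrite ler_norml => /andP[]; lra.
have bM (S : probability R R) :
    \int[S]_(y in setT) (g y + M) = \int[S]_(y in setT) g y + M.
  rewrite RintegralD ?Rintegral_prob_cst//; first exact: bmeas_integrable.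
  by apply: bmeas_integrable; split => //; exists M => x; rewrite ger0_norm.
have c1 : \sum_(1 <= k < n) p k * \int[convn P k]_(y in setT) (g y + M) @[n --> \oo] -->
    \int[mixture P]_(y in setT) (g y + M).
  under eq_cvg do rewrite -sum_wt.
  suff /fine_cvg : (\sum_(0 <= k < n) (wt k *
      \int[convn P k]_(y in setT) (g y + M))%:E)%E @[n --> \oo] -->
      (\int[mixture P]_(y in setT) (g y + M))%:E.
    by apply: cvg_trans; apply: near_eq_cvg; apply: nearW => n /=; rewrite sumEFin.
  rewrite EFin_Rintegral// [X in _ --> X](ge0_mixture_integral P bgM gM0).
  apply: is_cvg_nneseries => k _ _; rewrite lee_fin mulr_ge0 ?wt_ge0//.
  by rewrite /Rintegral fine_ge0// integral_ge0// => x _; rewrite lee_fin.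
have [_ [c2 _]] := hp.
have c3 : \sum_(1 <= k < n) p k * M @[n --> \oo] --> 1 * M.
  apply: eq_cvgn (cvgM c2 (cvg_cst M)) => n.
  by rewrite ?fctE /= mulr_suml.
have <- : \int[mixture P]_(y in setT) (g y + M) - 1 * M =
    \int[mixture P]_(y in setT) g y by rewrite bM mul1r addrK.
apply: eq_cvgn (cvgB c1 c3) => n.
rewrite ?fctE /= -sumrB.
by apply: eq_bigr => k _; rewrite bM mulrDr addrK.
Qed.

End mixture.

Lemma cvgn_le (R : realType) (u v : nat -> R) (l m : R) :
  u @ \oo --> l -> v @ \oo --> m -> (forall n, u n <= v n) -> l <= m.
Proof.
move=> ul vm uv; rewrite -(cvg_lim _ ul)// -(cvg_lim _ vm)//.
apply: ler_lim; [by apply/cvg_ex; exists l|by apply/cvg_ex; exists m|exact: nearW].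
Qed.

Section convn_bounds.
Context {R : realType}.
Implicit Types P : probability R R.

(** One factor is exchanged at a time, each at the cost of a shift [h]. The condition [h <= c] keeps
    the arguments below [b]: the other [k] factors weigh at least [k%:R * c], which outweighs the
    shift [k%:R * h] accumulated so far. *)
Lemma le_dist_convn P P' (b c h : R) : supp_ge c P -> supp_ge c P' ->
  0 <= h <= c -> (forall y, y < b -> dist P y <= dist P' (y + h) + h) ->
  forall k z, z < b ->
  dist (convn P k) z <= dist (convn P' k) (z + k%:R * h) + k%:R * h.
Proof.
move=> cP cP' /andP[h0 hc] PP'; elim=> [|k IH] z zb.
  by rewrite !dist_convn0 !mul0r !addr0.
rewrite -natr1 mulrDl mul1r !convnS.
apply: (@le_dist_conv _ _ _ _ _ c (k%:R * c) _ (z + k%:R * h)) => //.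
- exact (supp_ge_convn k cP').
- move=> u cu; have : z - u < b by lra.
  by move/IH; rewrite addrAC.
- move=> u ku; have kh : k%:R * h <= k%:R * c by exact: ler_wpM2l.
  have -> : z + (k%:R * h + h) - u = z + k%:R * h - u + h by ring.
  by apply: PP'; lra.
Qed.

Lemma dist_convnS_le P k x : supp_ge 0 P -> dist (convn P k.+1) x <= dist P x.
Proof.
move=> P0; rewrite convnS dist_convC dist_conv -[leRHS](Rintegral_prob_cst (convn P k)).
have k0 : supp_ge 0 (convn P k) by have := supp_ge_convn k P0; rewrite mulr0.
apply: (@le_Rintegral_supp _ _ _ _ _ 1 k0) => u; rewrite ?ger0_norm ?dist_ge0 ?dist_le1//.
by move=> u0; apply: le_dist; lra.
Qed.

(** Bernoulli's inequality: [k] independent sizes at most [c] have sum at most [k%:R * c], and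
    [dist P c ^+ k] is at least the left side. In the induction the slack is
    [k%:R * (1 - dist P c) ^+ 2]. *)
Lemma dist_convn_ge P k c : 1 - k%:R * (1 - dist P c) <= dist (convn P k) (k%:R * c).
Proof.
elim: k => [|k IH]; first by rewrite dist_convn0 !mul0r lexx subr0.
have e : dist P c * dist (convn P k) (k%:R * c) =
    \int[P]_(u in setT) (dist (convn P k) (k%:R * c) * below c u).
  have ib := bmeas_integrable P (bmeas_below c).
  by rewrite (RintegralZl _ measurableT ib) -dist_Rintegral mulrC.
apply: (@le_trans _ _ (dist P c * dist (convn P k) (k%:R * c))).
  have P0 := dist_ge0 P c; have P1 := dist_le1 P c.
  apply: le_trans (ler_wpM2l P0 IH); rewrite -natr1 -subr_ge0.
  have k0 : (0 : R) <= k%:R by exact: ler0n.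
  have : 0 <= k%:R * (1 - dist P c) ^+ 2 by rewrite mulr_ge0 ?sqr_ge0.
  by congr (_ <= _); ring.
rewrite e convnS dist_conv; apply: (@le_Rintegral_prob _ _ _ _ _ _ 1) => u.
- rewrite normrM ger0_norm ?dist_ge0// mulr_ile1 ?dist_ge0 ?dist_le1//.
  exact: below_bound.
- by rewrite ger0_norm ?dist_ge0 ?dist_le1.
- have [uc|uc] := leP u c; last by rewrite below0// mulr0 dist_ge0.
  by rewrite below1// mulr1; apply: le_dist; rewrite -natr1 mulrDl; lra.
Qed.

End convn_bounds.

Section mixture_bounds.
Context {R : realType}.
Variables (p : nat -> R) (hp : coag_weights p).
Implicit Types (P : probability R R).
Local Notation mix := (mixture hp).

Let p_ge0 k : (1 <= k)%N -> 0 <= p k. Proof. by have [h _] := hp; exact: h. Qed.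

Lemma cvg_sum_p : \sum_(1 <= k < n) p k @[n --> \oo] --> (1 : R).
Proof. by have [_ [h _]] := hp. Qed.

Lemma cvg_Q1 : \sum_(1 <= k < n) k%:R * p k @[n --> \oo] --> Q1 p.
Proof. by have [_ [_ h]] := hp; exact: h. Qed.

Lemma Q1_ge1 : 1 <= Q1 p.
Proof.
apply: (cvgn_le cvg_sum_p cvg_Q1) => n; rewrite !big_nat; apply: ler_sum => k /andP[k1 _].
by rewrite ler_peMl ?p_ge0// ler1n.
Qed.

Lemma Q1_gt0 : 0 < Q1 p. Proof. exact: lt_le_trans Q1_ge1. Qed.

Lemma cvg_dist_mixture P x :
  \sum_(1 <= k < n) p k * dist (convn P k) x @[n --> \oo] --> dist (mix P) x.
Proof.
have := @cvg_mixture_integral _ _ hp P _ (bmeas_below x); rewrite -dist_Rintegral.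
apply: eq_cvgn => n.
by apply: eq_bigr => k _; rewrite dist_Rintegral.
Qed.

Lemma le_dist_mixture P P' (x y c : R) :
  (forall k, (1 <= k)%N -> dist (convn P k) x <= dist (convn P' k) y + c) ->
  dist (mix P) x <= dist (mix P') y + c.
Proof.
move=> PP'.
have cv : \sum_(1 <= k < n) p k * (dist (convn P' k) y + c) @[n --> \oo] -->
    dist (mix P') y + 1 * c.
  apply: eq_cvgn (cvgD (@cvg_dist_mixture P' y) (cvgM cvg_sum_p (cvg_cst c))) => n.
  by rewrite ?fctE /= mulr_suml -big_split/=; under eq_bigr do rewrite -mulrDr.
rewrite -[c]mul1r; apply: (cvgn_le (@cvg_dist_mixture P x) cv) => n.
rewrite !big_nat; apply: ler_sum => k /andP[k1 _].
by rewrite ler_wpM2l ?p_ge0// PP'.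
Qed.

Lemma dist_mixture_ub P (x c : R) :
  (forall k, (1 <= k)%N -> dist (convn P k) x <= c) -> dist (mix P) x <= c.
Proof.
move=> Pc.
have cv : \sum_(1 <= k < n) p k * c @[n --> \oo] --> 1 * c.
  apply: eq_cvgn (cvgM cvg_sum_p (cvg_cst c)) => n; by rewrite ?fctE /= mulr_suml.
rewrite -[c]mul1r; apply: (cvgn_le (@cvg_dist_mixture P x) cv) => n.
rewrite !big_nat; apply: ler_sum => k /andP[k1 _].
by rewrite ler_wpM2l ?p_ge0// Pc.
Qed.

Lemma dist_mixture_le P x : supp_ge 0 P -> dist (mix P) x <= dist P x.
Proof. by move=> P0; apply: dist_mixture_ub => -[//|k] _; exact: dist_convnS_le. Qed.

Lemma supp_ge_mixture c P : 0 <= c -> supp_ge c P -> supp_ge c (mix P).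
Proof.
move=> c0 cP x xc; apply: dist_le0.
by rewrite (le_trans (dist_mixture_le _ _)) ?cP//; exact: supp_geW cP.
Qed.

(** The zero-shift case of [le_dist_convn]: all sizes being nonnegative, a sum below [b] only
    involves sizes below [b]. *)
Lemma le_dist_mixture_below P P' b : supp_ge 0 P -> supp_ge 0 P' ->
  (forall y, y < b -> dist P y <= dist P' y) ->
  forall z, z < b -> dist (mix P) z <= dist (mix P') z.
Proof.
move=> P0 P'0 PP' z zb; rewrite -[leRHS]addr0; apply: le_dist_mixture => k _.
have h y : y < b -> dist P y <= dist P' (y + 0) + 0 by rewrite !addr0; exact: PP'.
have := @le_dist_convn _ _ _ _ _ _ P0 P'0 _ h k _ zb; rewrite lexx mulr0 !addr0; exact.
Qed.

(** Powers [k >= j] have no mass below [j%:R * x0], so only shifts [k%:R * h] with [k < j] occur;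
    over the whole line the shifts would be unbounded in [k]. *)
Lemma le_dist_mixture_window P P' (x0 h : R) (j : nat) : supp_ge x0 P ->
  supp_ge x0 P' -> 0 <= h <= x0 ->
  (forall y, y < j%:R * x0 -> dist P y <= dist P' (y + h) + h) ->
  forall z, z < j%:R * x0 ->
  dist (mix P) z <= dist (mix P') (z + j%:R * h) + j%:R * h.
Proof.
move=> xP xP' hx PP' z zj; have /andP[h0 _] := hx.
apply: le_dist_mixture => k _; have [jk|kj] := leqP j k.
  rewrite (supp_ge_convn k xP) ?addr_ge0 ?dist_ge0 ?mulr_ge0//.
  by apply: (lt_le_trans zj); rewrite ler_wpM2r ?ler_nat//; lra.
have kh : k%:R * h <= j%:R * h by rewrite ler_wpM2r// ler_nat ltnW.
apply: le_trans (@le_dist_convn _ _ _ _ _ _ xP xP' hx PP' k _ zj) _.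
by apply: lerD => //; apply: le_dist; rewrite lerD2l.
Qed.

(** [K] is uniform in [P] and [z]. The weights beyond it sum to less than [e]; each remaining power
    has a deficit at most [k] times that of [P], and averaging [k] gives at most [Q1 p]. *)
Lemma dist_mixture_ge e : 0 < e -> exists2 K : R, 0 < K &
  forall P z, 0 <= z -> 1 - e - Q1 p * (1 - dist P (z / K)) <= dist (mix P) z.
Proof.
move=> e0; have /cvgrPdist_lt /(_ _ e0)[K _ /(_ K.+2)/= /(_ (leqW (leqnSn K))) h] := cvg_sum_p.
exists K.+1%:R => // P z z0; set c := z / _.
have partial (f : nat -> R) (l : R) n : (forall k, (1 <= k)%N -> 0 <= f k) ->
    \sum_(1 <= k < n) f k @[n --> \oo] --> l -> \sum_(1 <= k < n) f k <= l.
  move=> f0 fl; rewrite -(cvg_lim _ fl)//.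
  apply: (nondecreasing_cvgn_le (u_ := fun n => \sum_(1 <= k < n) f k)).
    apply/nondecreasing_seqP => m; case: m => [|m]; first by rewrite !big_geq.
    by rewrite [leRHS]big_nat_recr//= lerDl f0.
  by apply/cvg_ex; exists l.
have h1 : \sum_(1 <= k < K.+2) p k * dist (convn P k) z <= dist (mix P) z.
  apply: (partial _ _ _ _ (@cvg_dist_mixture P z)) => k k1.
  by rewrite mulr_ge0 ?p_ge0 ?dist_ge0.
have h2 : \sum_(1 <= k < K.+2) k%:R * p k <= Q1 p.
  by apply: (partial _ _ _ _ cvg_Q1) => k k1; rewrite mulr_ge0 ?p_ge0.
apply: le_trans h1.
apply: (@le_trans _ _ (\sum_(1 <= k < K.+2) p k * (1 - k%:R * (1 - dist P c)))).
  under eq_bigr do rewrite mulrBr mulr1 mulrA (mulrC (p _)).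
  rewrite sumrB -mulr_suml.
  have := dist_le1 P c; have := ler_norm (1 - \sum_(1 <= k < K.+2) p k).
  by move: h h2; set S := \sum_(_ <= _ < _) p _; set S' := \sum_(_ <= _ < _) _; nra.
rewrite !big_nat; apply: ler_sum => k /andP[k1 kK]; rewrite ler_wpM2l ?p_ge0//.
apply: le_trans (dist_convn_ge P k c) _; apply: le_dist.
rewrite /c mulrCA ler_piMr// ler_pdivrMr ?ltr0n// mul1r ler_nat//.
Qed.

End mixture_bounds.

(** * The min in terms of the distribution function *)

Section minp_dist.
Context {R : realType}.
Implicit Types P : probability R R.

Lemma on_RplusP P : on_Rplus P <-> supp_ge 0 P.
Proof.
split=> [P0 x x0|P0]; last by have := supp_ge_null P0; rewrite setCitvr.
apply: dist_le0; rewrite -lee_fin EFin_dist.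
apply: (@le_trans _ _ (P `]-oo, 0[%classic)); last by rewrite P0.
by apply: le_measure; rewrite ?inE//; apply: subset_itvl; rewrite bnd_simp.
Qed.

Lemma cdf_dist P x : supp_ge 0 P -> Defs.cdf P x = dist P x.
Proof.
move=> P0; rewrite /Defs.cdf; have [x0|x0] := ltP x 0.
  by rewrite P0// set_itv_ge ?measure0// bnd_simp -ltNge.
rewrite /dist (_ : `]-oo, x]%classic = `]-oo, 0[ `|` `[0, x]); last first.
  by rewrite -itv_bndbnd_setU// bnd_simp.
have PN := (on_RplusP P).2 P0.
rewrite measureU//; first by rewrite [X in (X + _)%E]PN add0e.
by apply/seteqP; split => // y []/=; rewrite !in_itv/= => y0 /andP[]; lra.
Qed.

Lemma minp_le P y : supp_ge 0 P -> 0 < dist P y -> minp P <= y.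
Proof.
move=> P0 Py; apply: ge_inf; last by rewrite /= cdf_dist.
exists 0 => x /=; rewrite cdf_dist// => /lt0r_neq0 Px.
by rewrite leNgt; apply: contra_neqN Px => x0; exact: P0.
Qed.

Lemma supp_ge_minp P : supp_ge 0 P -> supp_ge (minp P) P.
Proof.
move=> P0 y ym; apply: dist_le0; rewrite leNgt.
by apply: contraTN ym => /(minp_le P0); rewrite -leNgt.
Qed.

Lemma minp_ge c P : 0 <= c -> supp_ge c P -> c <= minp P.
Proof.
move=> c0 cP; have P0 := supp_geW c0 cP; apply: lb_le_inf.
  have [x _ Px] := dist_cvg1 P (ltr01 : 0 < 1 :> R).
  by exists x; rewrite /= cdf_dist//; move: Px; rewrite subrr.
move=> x /=; rewrite cdf_dist// => /lt0r_neq0 Px.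
by rewrite leNgt; apply: contra_neqN Px => xc; exact: cP.
Qed.

Lemma minp_ge0 P : supp_ge 0 P -> 0 <= minp P.
Proof. exact: minp_ge. Qed.

Lemma dist_gt0 P y : supp_ge 0 P -> minp P < y -> 0 < dist P y.
Proof.
move=> P0 my; rewrite lt0r dist_ge0 andbT; apply: contraTneq my => Py.
rewrite -leNgt; have [y0|y0] := ltP y 0; first by rewrite (le_trans (ltW y0))// minp_ge0.
apply: minp_ge => // x xy; apply: dist_le0.
by rewrite -Py; exact/le_dist/ltW.
Qed.

Lemma le_minp P P' : supp_ge 0 P -> supp_ge 0 P' ->
  (forall x, dist P' x <= dist P x) -> minp P <= minp P'.
Proof.
move=> P0 P'0 h; apply: minp_ge; first exact: minp_ge0.
move=> x xm; apply: dist_le0.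
by rewrite (le_trans (h _))// supp_ge_minp.
Qed.

End minp_dist.

(** * Integration against the logarithmic time *)

Section weighted_time_integral.
Context {R : realType}.
Variables (p : nat -> R) (hp : coag_weights p).
Let Q1_gt0 := Q1_gt0 hp.
Local Notation mu := (@lebesgue_measure R).

(** Integration against [dW], in the shape in which the weak equation has it. *)
Definition wI (a b : R) (g : R -> R) : R :=
  \int[mu]_(u in `[a, b]%classic) (g u / (Q1 p * u)).

Definition W (t : R) : R := ln t / Q1 p.

Lemma W_le (s t : R) : 0 < s -> s <= t -> W s <= W t.
Proof.
move=> s0 st; rewrite ler_pM2r ?invr_gt0// ler_ln ?posrE//.
exact: lt_le_trans st.
Qed.

Lemma W_lt (s t : R) : 0 < s -> s < t -> W s < W t.
Proof.
by move=> s0 st; rewrite ltr_pM2r ?invr_gt0// ltr_ln ?posrE//; exact: lt_trans st.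
Qed.

Lemma W_scale s d : 0 < s -> W (s * expR (Q1 p * d)) = W s + d.
Proof.
move=> s0; rewrite /W lnM ?posrE ?expR_gt0// expRK mulrDl [Q1 p * d]mulrC mulfK//.
exact: lt0r_neq0.
Qed.

Lemma W_div s t : 0 < s -> 0 < t -> ln (t / s) = Q1 p * (W t - W s).
Proof.
move=> s0 t0; rewrite ln_div ?posrE// /W -mulrBl mulrC divfK//.
exact: lt0r_neq0.
Qed.

Section fixed_bounds.
Variables (a b : R) (a0 : 0 < a) (ab : a <= b).

Let mab : (mu `[a, b]%classic < +oo)%E.
Proof. by rewrite lebesgue_measure_itv/=; case: ifP => _; rewrite ?ltry// -EFinB ltry. Qed.

Let weight_bound u : `[a, b]%classic u -> 0 < (Q1 p * u)^-1 <= (Q1 p * a)^-1.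
Proof.
rewrite /= in_itv/= => /andP[au _]; have u0 := lt_le_trans a0 au.
by rewrite invr_gt0 mulr_gt0//= lef_pV2 ?posrE ?mulr_gt0// ler_pM2l.
Qed.

Let mweight : measurable_fun `[a, b]%classic (fun u : R => (Q1 p * u)^-1).
Proof.
apply: subspace_continuous_measurable_fun => //.
apply: continuous_in_subspaceT => u; rewrite inE => /weight_bound/andP[u0 _].
apply: cvgV; first by rewrite gt_eqF// -invr_gt0.
by apply: cvgM; [exact: cvg_cst|exact: cvg_id].
Qed.

Let weighted_bound (g : R -> R) (M : R) : (forall u, a <= u <= b -> `|g u| <= M) ->
  forall u, `[a, b]%classic u -> `|g u / (Q1 p * u)| <= M / (Q1 p * a).
Proof.
move=> gM u uab; have /andP[w0 w1] := weight_bound uab.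
rewrite normrM (ger0_norm (ltW w0)) ler_pM// ?(ltW w0)//.
by apply: gM; move: uab; rewrite /= in_itv.
Qed.

Let weighted_measurable (g : R -> R) : measurable_fun `[a, b]%classic g ->
  measurable_fun `[a, b]%classic (fun u => g u / (Q1 p * u)).
Proof. by move=> mg; exact: measurable_funM mg mweight. Qed.

Lemma wI_integrable (g : R -> R) (M : R) : measurable_fun `[a, b]%classic g ->
  (forall u, a <= u <= b -> `|g u| <= M) ->
  mu.-integrable `[a, b]%classic (EFin \o (fun u => g u / (Q1 p * u))).
Proof.
move=> mg gM; apply: (bounded_integrable _ mab (weighted_measurable mg) (weighted_bound gM)) => //.
Qed.

Lemma le_wI (f g : R -> R) (M : R) : (forall u, a <= u <= b -> `|f u| <= M) ->
  (forall u, a <= u <= b -> `|g u| <= M) ->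
  (forall u, a <= u <= b -> f u <= g u) -> wI a b f <= wI a b g.
Proof.
move=> fM gM fg; apply: (le_Rintegral_nomeas _ mab (weighted_bound fM) (weighted_bound gM)) => // u uab.
have /andP[w0 _] := weight_bound uab; rewrite ler_pM2r//; apply: fg.
by move: uab; rewrite /= in_itv.
Qed.

Lemma eq_wI (f g : R -> R) : (forall u, a <= u <= b -> f u = g u) -> wI a b f = wI a b g.
Proof.
by move=> fg; apply: eq_Rintegral => u; rewrite inE/= in_itv/= => /fg ->.
Qed.

Lemma wIB (f g : R -> R) (M : R) :
  measurable_fun `[a, b]%classic f -> measurable_fun `[a, b]%classic g ->
  (forall u, a <= u <= b -> `|f u| <= M) -> (forall u, a <= u <= b -> `|g u| <= M) ->
  wI a b (fun u => f u - g u) = wI a b f - wI a b g.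
Proof.
move=> mf mg fM gM; rewrite /wI -RintegralB//.
- by apply: eq_Rintegral => u _; rewrite mulrBl.
- exact: wI_integrable mf fM.
- exact: wI_integrable mg gM.
Qed.

Lemma wI_lin (k : R) (f g : R -> R) (M : R) :
  measurable_fun `[a, b]%classic f -> measurable_fun `[a, b]%classic g ->
  (forall u, a <= u <= b -> `|f u| <= M) -> (forall u, a <= u <= b -> `|g u| <= M) ->
  wI a b (fun u => k * f u + g u) = k * wI a b f + wI a b g.
Proof.
move=> mf mg fM gM; have fi := wI_integrable mf fM; have gi := wI_integrable mg gM.
rewrite /wI -RintegralZl// -RintegralD//.
- by apply: eq_Rintegral => u _; rewrite mulrDl mulrA.
- by apply: (integrableZl _ _ fi).
Qed.

(** The endpoints are null. They are left out because the min may jump at an end of the interval. *)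
Lemma eq_wI_oo (f g : R -> R) :
  measurable_fun `[a, b]%classic f -> measurable_fun `[a, b]%classic g ->
  (forall u, a < u < b -> f u = g u) -> wI a b f = wI a b g.
Proof.
move=> mf mg fg; rewrite /wI /Rintegral; congr fine.
have sub : `]a, b[%classic `<=` `[a, b]%classic by apply: subset_itvW.
apply: (@eq_integral_itv_bounded _ a b _ _ true false).
- exact: measurable_funS sub (weighted_measurable mf).
- exact: measurable_funS sub (weighted_measurable mg).
- by move=> u; rewrite in_itv/= => /fg ->.
Qed.

Lemma wI_cvg (g_ : nat -> R -> R) (g : R -> R) (M : R) :
  (forall n, measurable_fun `[a, b]%classic (g_ n)) ->
  (forall n u, a <= u <= b -> `|g_ n u| <= M) ->
  (forall u, a <= u <= b -> g_ n u @[n --> \oo] --> g u) ->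
  wI a b (g_ n) @[n --> \oo] --> wI a b g.
Proof.
move=> mg gM gg.
apply: (@bounded_cvg_Rintegral _ _ _ mu _ _ mab _ _ (M / (Q1 p * a))) => // [n|n|u uab].
- exact: weighted_measurable.
- by apply: weighted_bound => u; exact: gM.
- by apply: cvgM; [apply: gg; move: uab; rewrite /= in_itv|exact: cvg_cst].
Qed.

End fixed_bounds.

Lemma wI_cst (a b k : R) : 0 < a -> a <= b -> wI a b (fun=> k) = k * (W b - W a).
Proof.
move=> a0; rewrite le_eqVlt => /predU1P[<-|ab].
  by rewrite /wI set_itv1 Rintegral_set1 subrr mulr0.
pose F (u : R) := k / Q1 p * ln u.
have dF (u : R) : 0 < u -> is_derive u 1 F (k / Q1 p * u^-1).
  by move=> u0; have := is_derive1_ln u0; exact: is_deriveZ.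
rewrite /wI /Rintegral (@continuous_FTC2 _ (fun u => k / (Q1 p * u)) F)//.
- by rewrite -EFinB /= /F /W; ring.
- apply: continuous_in_subspaceT => u; rewrite inE/= in_itv/= => /andP[au _].
  have u0 := lt_le_trans a0 au.
  apply: cvgM; first exact: cvg_cst.
  apply: cvgV; first by rewrite gt_eqF// mulr_gt0.
  by apply: cvgM; [exact: cvg_cst|exact: cvg_id].
- have cF (u : R) : 0 < u -> F v @[v --> u] --> F u.
    by move=> u0; apply: cvgM; [exact: cvg_cst|exact: continuous_ln].
  split.
  + move=> u; rewrite in_itv/= => /andP[au _].
    by have [] := dF _ (lt_trans a0 au).
  + by apply: cvg_at_right_filter; exact: cF.
  + by apply: cvg_at_left_filter; apply: cF; exact: lt_trans ab.
- move=> u; rewrite in_itv/= => /andP[au _]; have u0 := lt_trans a0 au.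
  by rewrite derive1E (@derive_val _ _ _ _ _ _ _ (dF _ u0)) -mulrA -invfM.
Qed.

Lemma wI_split (a b c : R) (g : R -> R) (M : R) : 0 < a -> a <= b -> b <= c ->
  measurable_fun `[a, c]%classic g -> (forall u, a <= u <= c -> `|g u| <= M) ->
  wI a c g = wI a b g + wI b c g.
Proof.
move=> a0 ab bc mg gM; have ac := le_trans ab bc.
have ig := wI_integrable a0 mg gM.
have := Rintegral_itvB ig (x := b); rewrite !bnd_simp => /(_ ab bc).
rewrite Rintegral_itv_obnd_cbnd; last first.
  by apply: integrableS ig => //; apply: subset_itvr; rewrite bnd_simp.
by rewrite /wI => <-; rewrite addrC subrK.
Qed.

End weighted_time_integral.

Lemma noninc_on_measurable (R : realType) (a b : R) (g : R -> R) : a <= b ->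
  (forall u v, a <= u -> u <= v -> v <= b -> g v <= g u) ->
  measurable_fun `[a, b]%classic g.
Proof.
(* Clamping the argument to [[a, b]] turns monotonicity on the interval into monotonicity on the
   line. *)
move=> ab gni; pose cl u := Num.max a (Num.min u b).
have cl_ab u : a <= cl u <= b by rewrite /cl le_max lexx /= ge_max ab /= ge_min lexx orbT.
have cl_le u v : u <= v -> cl u <= cl v.
  move=> uv; rewrite /cl; case: (leP u b) => ub; case: (leP v b) => vb;
    rewrite ge_max !le_max lexx /=; apply/orP; right; lra.
apply: (eq_measurable_fun (g \o cl)).
  move=> u; rewrite inE/= in_itv/= => /andP[au ub].
  by rewrite /cl min_l// max_r.
apply: nonincreasing_measurable => // u v uv; have /andP[? ?] := cl_ab u.
by have /andP[? ?] := cl_ab v; apply: gni => //; exact: cl_le.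
Qed.

(** * The fixed-point equation *)

Section gain.
Context {R : realType}.
Variables (p : nat -> R) (hp : coag_weights p).
Implicit Types (P : probability R R) (F G : R -> probability R R).
Local Notation mix := (mixture hp).
Local Notation wI := (wI p).
Local Notation W := (W p).

Definition gain1 P x := dist (mix P) (x - minp P).

Definition gain F x u := gain1 (F u) x.

Lemma gain1_ge0 P x : 0 <= gain1 P x. Proof. exact: dist_ge0. Qed.

Lemma gain1_le1 P x : gain1 P x <= 1. Proof. exact: dist_le1. Qed.

Lemma gain_bound F x u : `|gain F x u| <= 1.
Proof. by rewrite ger0_norm ?gain1_ge0 ?gain1_le1. Qed.

Lemma le_gain1 P x y : x <= y -> gain1 P x <= gain1 P y.
Proof. by move=> xy; apply: le_dist; rewrite lerB. Qed.

Lemma gain1_right_cvg P x : gain1 P (x + n.+1%:R^-1) @[n --> \oo] --> gain1 P x.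
Proof.
apply: eq_cvgn (@dist_right_cvg _ (mix P) (x - minp P)) => n.
by rewrite /gain1 addrAC.
Qed.

Lemma gain1_le P x : supp_ge 0 P -> gain1 P x <= dist P x.
Proof.
move=> P0; apply: le_trans (dist_mixture_le _ _ P0) _.
by apply: le_dist; rewrite gerBl minp_ge0.
Qed.

(** A new cluster is the min plus at least one sampled size, each of them at least [c]. *)
Lemma gain1_eq0 P x c : 0 <= c -> supp_ge c P -> x < c + c -> gain1 P x = 0.
Proof.
move=> c0 cP xc; have P0 := supp_geW c0 cP; apply: (@supp_ge_mixture _ _ _ c) => //.
have := minp_ge c0 cP; lra.
Qed.

(** Less mass at small sizes raises the min and lowers the mixture, and both lower the gain. Along a
    solution this makes the gain nonincreasing in time. *)
Lemma gain1_mono P P' x : supp_ge 0 P -> supp_ge 0 P' ->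
  (forall y, dist P' y <= dist P y) -> gain1 P' x <= gain1 P x.
Proof.
move=> P0 P'0 PP'; have mm := le_minp P0 P'0 PP'.
apply: (@le_trans _ _ (dist (mix P) (x - minp P'))).
  apply: (@le_dist_mixture_below _ _ _ _ _ (x - minp P' + 1)) => //.
  by rewrite ltrDl.
by apply: le_dist; rewrite lerB.
Qed.

Lemma wI_gain_le F x (s t k : R) : 0 < s -> s <= t ->
  (forall u, s <= u <= t -> gain F x u <= k) -> wI s t (gain F x) <= k * (W t - W s).
Proof.
move=> s0 st gk; rewrite -(wI_cst hp)//.
apply: (@le_wI _ _ hp _ _ s0 _ _ (1 + `|k|)) => // u _.
  by rewrite (le_trans (gain_bound _ _ _))// lerDl.
by rewrite lerDr.
Qed.

Lemma wI_gain_ge F x (s t k : R) : 0 < s -> s <= t ->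
  (forall u, s <= u <= t -> k <= gain F x u) -> k * (W t - W s) <= wI s t (gain F x).
Proof.
move=> s0 st gk; rewrite -(wI_cst hp)//.
apply: (@le_wI _ _ hp _ _ s0 _ _ (1 + `|k|)) => // u _.
  by rewrite lerDr.
by rewrite (le_trans (gain_bound _ _ _))// lerDl.
Qed.

Lemma wI_gain_le_W F x (s t : R) : 0 < s -> s <= t ->
  0 <= wI s t (gain F x) <= W t - W s.
Proof.
move=> s0 st; apply/andP; split.
  rewrite -[leLHS](mul0r (W t - W s)); apply: wI_gain_ge => // u _; exact: gain1_ge0.
by rewrite -[leRHS]mul1r; apply: wI_gain_le => // u _; exact: gain1_le1.
Qed.

Lemma minp_agree P P' b : supp_ge 0 P -> supp_ge 0 P' ->
  (forall y, y < b -> dist P y = dist P' y) -> minp P < b -> minp P' = minp P.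
Proof.
move=> P0 P'0 PP' mb; apply/eqP; rewrite eq_le; apply/andP; split.
  apply/ler_addgt0Pl => e e0; set y := Num.min (e + minp P) ((minp P + b) / 2).
  have my : minp P < y by rewrite /y lt_min; apply/andP; split; lra.
  have yb : y < b by rewrite /y gt_min; apply/orP; right; lra.
  apply: (@le_trans _ _ y); last by rewrite /y ge_min lexx.
  by apply: minp_le => //; rewrite -PP'//; exact: dist_gt0.
apply: minp_ge; first exact: minp_ge0.
by move=> y ym; rewrite -PP' ?(supp_ge_minp P0)//; exact: lt_trans mb.
Qed.

(** As the min is at least [c], the argument [x - minp P] lies one window lower. A min beyond that
    lower window is out of reach of [minp_agree], but it exceeds [x / 2], so that both gains
    vanish. *)
Lemma gain1_agree P P' c (j : nat) x : 0 < c -> supp_ge c P -> supp_ge c P' ->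
  (forall y, y < j.+1%:R * c -> dist P y = dist P' y) ->
  x < j.+2%:R * c -> gain1 P x = gain1 P' x.
Proof.
move=> c0 cP cP' PP' xj.
have P0 := supp_geW (ltW c0) cP; have P'0 := supp_geW (ltW c0) cP'.
have jS : j.+2%:R * c = j.+1%:R * c + c by rewrite -natr1 mulrDl mul1r.
have jc : c <= j.+1%:R * c by rewrite ler_peMl ?ler1n// ltW.
have [mj|jm] := ltP (minp P) (j.+1%:R * c).
  rewrite /gain1 (minp_agree P0 P'0 PP' mj).
  have := minp_ge (ltW c0) cP => cm.
  apply/eqP; rewrite eq_le; apply/andP; split;
    apply: (@le_dist_mixture_below _ _ _ _ _ (j.+1%:R * c)) => //; try lra;
    by move=> y /PP' ->.
have mj' : j.+1%:R * c <= minp P'.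
  rewrite leNgt; apply/negP => m'j.
  have PP'' y : y < j.+1%:R * c -> dist P' y = dist P y by move/PP'.
  by have := minp_agree P'0 P0 PP'' m'j; lra.
rewrite (gain1_eq0 (minp_ge0 P0) (supp_ge_minp P0)); last by lra.
by rewrite (gain1_eq0 (minp_ge0 P'0) (supp_ge_minp P'0))//; lra.
Qed.

Definition good a b F :=
  (forall u, a <= u <= b -> supp_ge 0 (F u)) /\
  (forall u v x, a <= u -> u <= v -> v <= b -> dist (F v) x <= dist (F u) x).

Section good_path.
Variables (a b : R) (a0 : 0 < a) (F : R -> probability R R) (gF : good a b F).

Lemma good_supp c t : a <= t <= b -> supp_ge c (F a) -> supp_ge c (F t).
Proof.
move=> /andP[at_ tb] ca x xc; apply: dist_le0; rewrite -(ca x xc).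
by have [_] := gF; apply.
Qed.

Lemma good_le_minp u v : a <= u -> u <= v -> v <= b -> minp (F u) <= minp (F v).
Proof.
move=> au uv vb; have [s n] := gF.
apply: le_minp; [apply: s|apply: s|by move=> x; exact: n]; apply/andP; split => //.
- exact: le_trans vb.
- exact: le_trans uv.
Qed.

Lemma gain_noninc x u v : a <= u -> u <= v -> v <= b -> gain F x v <= gain F x u.
Proof.
move=> au uv vb; have [s n] := gF.
apply: gain1_mono; [apply: s|apply: s|by move=> y; exact: n]; apply/andP; split => //.
- exact: le_trans vb.
- exact: le_trans uv.
Qed.

Lemma gain_measurable x s t : a <= s -> s <= t -> t <= b ->
  measurable_fun `[s, t]%classic (gain F x).
Proof.
move=> as_ st tb; apply: noninc_on_measurable => // u v su uv vt.
by apply: gain_noninc => //; [exact: le_trans su|exact: le_trans tb].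
Qed.

Lemma wI_gain_split x s r t : a <= s -> s <= r -> r <= t -> t <= b ->
  wI s t (gain F x) = wI s r (gain F x) + wI r t (gain F x).
Proof.
move=> as_ sr rt tb; have st := le_trans sr rt.
apply: (@wI_split _ _ hp _ _ _ _ 1) => //; first exact: lt_le_trans as_.
- exact: gain_measurable.
- by move=> u _; exact: gain_bound.
Qed.

End good_path.

(** Required between any two times and not only from [a], so that a solution can be restarted
    later. *)
Definition fp a b F := good a b F /\
  forall s t x, a <= s -> s <= t -> t <= b ->
  dist (F t) x = Num.max 0 (dist (F s) x + wI s t (gain F x) - (W t - W s)).

Section fixed_point.
Variables (a b : R) (a0 : 0 < a) (F : R -> probability R R) (fpF : fp a b F).
Let gF : good a b F. Proof. by case: fpF. Qed.

(** The gain at [y] is at most [dist (F s) y <= e] from [s] on, so the net loss rate is at least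
    [1 - e >= 1/2], and W-time [2 * e] exhausts a mass [e]. *)
Lemma fp_vanish s t y e : a <= s -> s <= t -> t <= b -> dist (F s) y <= e ->
  e <= 2^-1 -> 2 * e <= W t - W s -> dist (F t) y = 0.
Proof.
move=> as_ st tb ye e2 Wst; rewrite (fpF.2 s t y)//; apply: max_l.
have g u : s <= u <= t -> gain F y u <= e.
  move=> /andP[su ut]; have [s0 n0] := gF; apply: le_trans ye.
  apply: (@le_trans _ _ (gain F y s)).
    by apply: (gain_noninc gF) => //; exact: le_trans tb.
  by apply: gain1_le; apply: s0; rewrite as_ (le_trans st).
have := wI_gain_le (lt_le_trans a0 as_) st g.
have : W s <= W t by apply: (W_le hp) => //; exact: lt_le_trans as_.
have := dist_ge0 (F s) y; nra.
Qed.

Lemma fp_double s t : a <= s -> s <= t -> t <= b -> 1 <= W t - W s ->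
  2 * minp (F s) <= minp (F t).
Proof.
move=> as_ st tb Wst; have [s0 n0] := gF.
have Fs : supp_ge 0 (F s) by apply: s0; rewrite as_ (le_trans st).
have m0 := minp_ge0 Fs.
apply: minp_ge; first by rewrite mulr_ge0.
move=> x xm; rewrite (fpF.2 s t x)//; apply: max_l.
have g u : s <= u <= t -> gain F x u <= 0.
  move=> /andP[su ut]; rewrite le_eqVlt /gain (gain1_eq0 m0) ?eqxx//; last by lra.
  move=> y ym; apply: dist_le0; rewrite -(supp_ge_minp Fs ym).
  by apply: n0 => //; exact: le_trans tb.
have := wI_gain_le (lt_le_trans a0 as_) st g; have := dist_le1 (F s) x; lra.
Qed.

End fixed_point.

Lemma fp_unique a b F G : 0 < a -> fp a b F -> fp a b G ->
  0 < minp (F a) -> dist (F a) =1 dist (G a) ->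
  forall t, a <= t <= b -> dist (F t) =1 dist (G t).
Proof.
move=> a0 fF fG m0 FG t atb.
have [gF eF] := fF; have [gG eG] := fG.
have aab : a <= a <= b by move: atb => /andP[at_ tb]; rewrite lexx (le_trans at_).
have F0 : supp_ge 0 (F a) by have [s _] := gF; exact: s.
set c := minp (F a) in m0.
have cF u : a <= u <= b -> supp_ge c (F u).
  by move=> uab; apply: (good_supp gF uab) => //; exact: supp_ge_minp.
have cG u : a <= u <= b -> supp_ge c (G u).
  move=> uab; apply: (good_supp gG uab) => x xc.
  by rewrite -FG; exact: (cF a).
have agree (j : nat) : forall u x, a <= u <= b -> x < j.+1%:R * c ->
    dist (F u) x = dist (G u) x.
  elim: j => [|j IH] u x uab xj.
    by rewrite mul1r in xj; rewrite (cF u uab)// (cG u uab).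
  have /andP[au ub] := uab.
  rewrite (eF a u x (lexx a) au ub) (eG a u x (lexx a) au ub) FG.
  suff -> : wI a u (gain F x) = wI a u (gain G x) by [].
  apply: eq_wI => v /andP[av vu].
  have vab : a <= v <= b by rewrite av (le_trans vu).
  apply: (gain1_agree m0 (cF v vab) (cG v vab) _ xj) => y.
  exact: IH.
move=> x; apply: (agree (Num.truncn (x / c))) => //.
by rewrite -ltr_pdivrMr// truncnS_gt.
Qed.

End gain.

Lemma cvg_max0 (R : realType) (u : nat -> R) (l : R) :
  u @ \oo --> l -> Num.max 0 (u n) @[n --> \oo] --> Num.max 0 l.
Proof.
have e (x : R) : Num.max 0 x = (x + `|x|) * 2^-1.
  by case: (leP 0 x) => x0; rewrite ?(ger0_norm x0) ?(ltr0_norm x0); lra.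
move=> ul; rewrite e.
have un : `|u n| @[n --> \oo] --> `|l| by apply: cvg_norm; exact: ul.
by apply: eq_cvgn (cvgM (cvgD ul un) (cvg_cst (2^-1 : R))) => n; rewrite e.
Qed.

(** * Existence *)

Section existence.
Context {R : realType}.
Variables (p : nat -> R) (hp : coag_weights p).
Variables (t0 : R) (t0_gt0 : 0 < t0) (P0 : probability R R).
Variables (c : R) (c0 : 0 < c) (cP0 : supp_ge c P0).
Implicit Types (F G : R -> probability R R).
Local Notation mix := (mixture hp).
Local Notation wI := (wI p).
Local Notation W := (W p).
Local Notation gain1 := (gain1 hp).
Local Notation gain := (gain hp).

Definition admissible F :=
  (forall b, good t0 b F) /\ (forall u, t0 <= u -> supp_ge c (F u)).

Definition rhs F t x := dist P0 x + wI t0 t (gain F x) - (W t - W t0).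

Definition step F G := forall t x, t0 <= t -> dist (G t) x = Num.max 0 (rhs F t x).

Let W_ge t : t0 <= t -> W t0 <= W t. Proof. exact: W_le. Qed.

(** On [[s, t]] the gain lies between its final value, by monotonicity in time, and 1. The upper
    bound makes [rhs] nonincreasing in time, so that iterates stay admissible; the lower one
    controls the loss of total mass. *)
Lemma rhs_incr F s t x : admissible F -> t0 <= s -> s <= t ->
  rhs F s x - (W t - W s) * (1 - gain F x t) <= rhs F t x <= rhs F s x.
Proof.
move=> [gF _] ts st; rewrite /rhs (wI_gain_split hp t0_gt0 (gF t) x (lexx _) ts st)//.
have s0 := lt_le_trans t0_gt0 ts.
have /andP[_] := wI_gain_le_W hp F x s0 st.
have h u : s <= u <= t -> gain F x t <= gain F x u.
  move=> /andP[su ut].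
  exact: (gain_noninc hp (gF t) x (le_trans ts su) ut (lexx t)).
have := wI_gain_ge s0 st h.
by set A := _ * (W t - W s) => h1 h2; rewrite {}/A in h1; apply/andP; split; lra.
Qed.

Lemma rhs_t0 F x : admissible F -> rhs F t0 x = dist P0 x.
Proof.
move=> [gF _]; rewrite /rhs.
have := wI_gain_le_W hp F x t0_gt0 (lexx t0); lra.
Qed.

Lemma step_admissible F G : admissible F -> step F G -> admissible G.
Proof.
move=> aF FG.
have Gc u : t0 <= u -> supp_ge c (G u).
  move=> tu x xc; rewrite FG//; apply: max_l; have /andP[_] := rhs_incr x aF (lexx _) tu.
  by rewrite rhs_t0// cP0.
split => // b; split => [u /andP[tu _]|u v x tu uv vb].
  exact: supp_geW (ltW c0) (Gc _ tu).
rewrite !FG//; last exact: le_trans uv.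
have /andP[_ h] := rhs_incr x aF tu uv.
by rewrite ge_max le_max lexx/= le_max h orbT.
Qed.

Lemma step_exists F : admissible F -> exists G, step F G.
Proof.
move=> aF; have [gF cF] := aF.
suff /choice[G h] : forall t, exists P, t0 <= t -> forall x, dist P x = Num.max 0 (rhs F t x).
  by exists G => t x tt; exact: h.
(* Times before [t0] get the arbitrary value [P0]. *)
move=> t; have [tt|tt] := pselect (t0 <= t); last by exists P0 => /tt.
have dW := W_ge tt.
suff [P h] : exists P : probability R R, dist P =1 (fun x => Num.max 0 (rhs F t x)).
  by exists P => _.
have le_rhs x : rhs F t x <= dist P0 x.
  by have /andP[_] := rhs_incr x aF (lexx _) tt; rewrite rhs_t0.
apply: exists_prob.
- move=> x y xy; rewrite ge_max le_max lexx/= le_max; apply/orP; right.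
  apply: lerB; last exact: lexx.
  apply: lerD; first exact: le_dist.
  apply: (@le_wI _ _ hp _ _ t0_gt0 _ _ 1) => // u _; try exact: gain_bound.
  exact: le_gain1.
- move=> x; apply: cvg_max0.
  apply: cvgB; last exact: cvg_cst; apply: cvgD; first exact: dist_right_cvg.
  apply: (@wI_cvg _ _ hp _ _ t0_gt0 _ _ 1) => //.
  + by move=> n; apply: (gain_measurable hp (gF t)).
  + by move=> n u _; exact: gain_bound.
  + by move=> u _; exact: gain1_right_cvg.
- move=> x x0; apply: max_l; rewrite (le_trans (le_rhs _))// cP0//.
  exact: lt_trans c0.
- by move=> x; rewrite ge_max ler01 (le_trans (le_rhs _))// dist_le1.
(* Chosen for [(W t - W t0) * d <= e / 2]; the added 1 keeps the denominator positive at
   [t = t0]. *)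
- move=> e e0; pose d := e / (2 * (1 + (W t - W t0))).
  have d0 : 0 < d by rewrite divr_gt0// mulr_gt0//; lra.
  have e20 : 0 < e / 2 by lra.
  have [x1 _ h1] := dist_cvg1 P0 e20.
  have [x2 _ h2] := dist_cvg1 (mix (F t)) d0.
  pose x := Num.max x1 (x2 + minp (F t)); exists x.
  have h1' : 1 - e / 2 < dist P0 x.
    by apply: (lt_le_trans h1); apply: le_dist; rewrite /x le_max lexx.
  have h2' : 1 - d < gain F x t.
    by apply: (lt_le_trans h2); apply: le_dist; rewrite lerBrDr /x le_max lexx orbT.
  have /andP[h3 _] := rhs_incr x aF (lexx _) tt.
  rewrite lt_max; apply/orP; right; apply: lt_le_trans h3; rewrite rhs_t0//.
  have : (W t - W t0) * (1 - gain F x t) <= (W t - W t0) * d by rewrite ler_wpM2l//; lra.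
  have : (1 + (W t - W t0)) * d = e / 2.
    by rewrite /d; field; lra.
  lra.
Qed.

Fact admissible_cst : admissible (fun=> P0).
Proof. by split => [b|//]; split => // u _; exact: supp_geW (ltW c0) cP0. Qed.

Lemma iterates_exist : exists Fn : nat -> R -> probability R R,
  (forall n, admissible (Fn n)) /\ (forall n, step (Fn n) (Fn n.+1)).
Proof.
have /choice[nxt h] : forall F, exists G, admissible F -> step F G.
  move=> F; have [/step_exists[G FG]|nF] := pselect (admissible F).
    by exists G.
  by exists F => /nF.
pose Fn n := iter n nxt (fun=> P0).
have aFn n : admissible (Fn n).
  elim: n => [|n IH]; first exact: admissible_cst.
  exact: step_admissible IH (h _ IH).
by exists Fn; split => // n; exact: h.
Qed.

Section limit.
Variable Fn : nat -> R -> probability R R.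
Hypotheses (aFn : forall n, admissible (Fn n)) (sFn : forall n, step (Fn n) (Fn n.+1)).

Lemma iterates_agree n m u x : t0 <= u -> x < n.+1%:R * c ->
  dist (Fn (n + m)%N u) x = dist (Fn n u) x.
Proof.
elim: n u x => [|n IH] u x tu xn.
  by rewrite mul1r in xn; rewrite (aFn _).2// (aFn _).2.
rewrite addSn (sFn _ _ tu) (sFn _ _ tu); suff -> : rhs (Fn (n + m)%N) u x = rhs (Fn n) u x by [].
rewrite /rhs; suff -> : wI t0 u (gain (Fn (n + m)%N) x) = wI t0 u (gain (Fn n) x) by [].
apply: eq_wI => v /andP[tv _].
apply: (gain1_agree hp c0 ((aFn _).2 v tv) ((aFn _).2 v tv) _ xn) => y.
exact: IH.
Qed.

(** At [x] the iterates are constant from the index of the window of [x] on, so their limit is read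
    off there. *)
Definition limdist t x := dist (Fn (Num.truncn (x / c)) t) x.

Lemma limdistE n t x : t0 <= t -> x < n.+1%:R * c -> limdist t x = dist (Fn n t) x.
Proof.
move=> tt xn; rewrite /limdist.
have /subnKC <- : (Num.truncn (x / c) <= n)%N by rewrite truncn_le_nat ltr_pdivrMr.
by rewrite iterates_agree// -ltr_pdivrMr// truncnS_gt.
Qed.

Lemma window x : exists n : nat, x < n.+1%:R * c.
Proof. by exists (Num.truncn (x / c)); rewrite -ltr_pdivrMr// truncnS_gt. Qed.

Lemma windowW n m x : (n <= m)%N -> x < n.+1%:R * c -> x < m.+1%:R * c.
Proof. by move=> nm /lt_le_trans; apply; rewrite ler_wpM2r ?(ltW c0)// ler_nat. Qed.

Lemma le_limdist t x y : t0 <= t -> x <= y -> limdist t x <= limdist t y.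
Proof.
move=> tt xy; have [n yn] := window y.
by rewrite (limdistE tt yn) (limdistE tt (le_lt_trans xy yn)); exact: le_dist.
Qed.

Lemma limdist_le1 t x : limdist t x <= 1.
Proof. exact: dist_le1. Qed.

(** Taking positive parts cannot increase the drop from [s] to [t]. The gain is that of [Fn n], one
    index before the iterate [Fn n.+1] whose values are compared. *)
Lemma limdist_step n s t x : t0 <= s -> s <= t -> x < n.+1%:R * c ->
  limdist s x - (W t - W s) * (1 - gain (Fn n) x t) <= limdist t x.
Proof.
move=> ts st xn; have tt := le_trans ts st; have xn' := windowW (leqnSn n) xn.
rewrite (limdistE ts xn') (limdistE tt xn') !(sFn n) //.
have /andP[h1 h2] := rhs_incr x (aFn n) ts st.
have h3 : 0 <= (W t - W s) * (1 - gain (Fn n) x t).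
  rewrite mulr_ge0 ?subr_ge0 ?gain1_le1// W_le//; exact: lt_le_trans ts.
rewrite lerBlDr; case: (leP 0 (rhs (Fn n) s x)) => hs.
  have : rhs (Fn n) t x <= Num.max 0 (rhs (Fn n) t x) by rewrite le_max lexx orbT.
  lra.
have : 0 <= Num.max 0 (rhs (Fn n) t x) by rewrite le_max lexx.
lra.
Qed.

Definition full_mass t := forall e, 0 < e -> exists x, 1 - e < limdist t x.

(* The mass deficit [d = 1 - S] at time [t] obeys [d <= (W t - W s) Q1 d], since
   the gain rate is smallest at the final time. *)
Lemma full_mass_step s t : t0 <= s -> s <= t -> Q1 p * (W t - W s) <= 2^-1 ->
  full_mass s -> full_mass t.
Proof.
move=> ts st QW ms; have tt := le_trans ts st.
have Q1g := Q1_ge1 hp.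
have D0 : 0 <= W t - W s by rewrite subr_ge0 W_le//; exact: lt_le_trans ts.
have D1 : W t - W s <= 2^-1 by nra.
(* A level with positive mass at time [t]; it will bound [minp (Fn n t)] independently of [n]. More
   than 3/4 of the mass lies below [x] at time [s], and at most 1/2 is lost. *)
have [y0 fy0] : exists y0, 0 < limdist t y0.
  have /ms[x sx] : 0 < 4^-1 :> R by [].
  have [n xn] := window x; have := limdist_step ts st xn.
  have := gain1_ge0 hp (Fn n t) x; rewrite -/(gain _ _ _) => g0.
  exists x; nra.
pose A := range (limdist t).
have supA : has_sup A.
  by split; [exists (limdist t 0), 0|exists 1 => _ [x _ <-]; exact: limdist_le1].
have ubA x : limdist t x <= sup A by apply: ub_le_sup; [exact: supA.2|exists x].
suff S1 : 1 <= sup A.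
  move=> e e0; have [_ [x _ <-] h] := sup_adherent e0 supA; exists x; lra.
apply/ler_addgt0Pr => e e0; pose d := e / 4; have d0 : 0 < d by rewrite /d; lra.
have [_ [x2 _ <-] hx2] := sup_adherent d0 supA.
have [x1 hx1] := ms _ d0.
have [K K0 mixK] := dist_mixture_ge hp d0.
(* With [x = y0 + K * z] one has [x - minp (Fn n t) >= K * z], where the bound on the mixture
   involves the mass below [z >= x2]; and [z] is large enough for [x >= x1]. *)
pose z := Num.max 0 (Num.max x2 ((x1 - y0) / K)).
have z0 : 0 <= z by rewrite /z le_max lexx.
have zx2 : x2 <= z by rewrite /z !le_max lexx !orbT.
pose x := y0 + K * z.
have x1x : x1 <= x.
  by rewrite /x -lerBlDl -ler_pdivrMl// mulrC /z !le_max lexx !orbT.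
have [n1 xn1] := window x; have [n2 zn2] := window z; have [n3 yn3] := window y0.
pose n := maxn n1 (maxn n2 n3).
have xn : x < n.+1%:R * c by apply: windowW xn1; rewrite leq_maxl.
have zn : z < n.+1%:R * c by apply: windowW zn2; rewrite !leq_max leqnn !orbT.
have yn : y0 < n.+1%:R * c by apply: windowW yn3; rewrite !leq_max leqnn !orbT.
have Fn0 : supp_ge 0 (Fn n t) by apply: supp_geW (ltW c0) ((aFn n).2 t tt).
have my0 : minp (Fn n t) <= y0 by apply: minp_le => //; rewrite -(limdistE tt yn).
have hg : 1 - d - Q1 p * (1 - (sup A - d)) <= gain (Fn n) x t.
  apply: (@le_trans _ _ (dist (mix (Fn n t)) (x - y0))); last by apply: le_dist; rewrite lerB.
  have Kz0 : 0 <= K * z by rewrite mulr_ge0// ltW.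
  have := mixK (Fn n t) (K * z) Kz0; rewrite mulrAC divff ?mul1r ?lt0r_neq0//.
  have -> : x - y0 = K * z by rewrite /x addrAC subrr add0r.
  apply: le_trans; rewrite lerD2l lerN2 ler_pM2l ?(Q1_gt0 hp)// lerD2l lerN2.
  rewrite -(limdistE tt zn); apply: le_trans (ltW hx2) _; exact: le_limdist.
have h1 := limdist_step ts st xn.
have h2 : limdist s x1 <= limdist s x by exact: le_limdist.
have h3 := ubA x.
have h4 : (W t - W s) * (1 - gain (Fn n) x t) <=
    (W t - W s) * (d + Q1 p * (1 - (sup A - d))) by rewrite ler_wpM2l//; lra.
have S1 : sup A <= 1 by apply: ge_sup; [exact: supA.1|move=> _ [y _ <-]; exact: limdist_le1].
have h5 : Q1 p * (W t - W s) * (1 - (sup A - d)) <= 2^-1 * (1 - (sup A - d)).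
  by rewrite ler_wpM2r//; lra.
have h6 : (W t - W s) * d <= 2^-1 * d by rewrite ler_wpM2r// ltW.
(* With [r = 1 - sup A] the estimates give [r <= d + d / 2 + (r + d) / 2], that is [r <= 4 * d]. *)
have e4 : e = 4 * d by rewrite /d; lra.
nra.
Qed.

(** Induction on the number of steps of W-length [(2 * Q1 p)^-1] that lead from [t0] to [t]. *)
Lemma full_mass_all t : t0 <= t -> full_mass t.
Proof.
have Q0 := Q1_gt0 hp.
suff h (n : nat) : forall t, t0 <= t -> Q1 p * (W t - W t0) <= n%:R / 2 -> full_mass t.
  move=> tt; apply: (h (Num.truncn (2 * (Q1 p * (W t - W t0)))).+1) => //.
  have := truncnS_gt (2 * (Q1 p * (W t - W t0))); lra.
have base s : t0 <= s -> Q1 p * (W s - W t0) <= 2^-1 -> full_mass s.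
  move=> ts Ws; apply: (full_mass_step (lexx t0) ts Ws) => e e0.
  have [x _ hx] := dist_cvg1 P0 e0; exists x; have [m xm] := window x.
  rewrite (limdistE (lexx _) (windowW (leqnSn m) xm)) sFn// rhs_t0//.
  by rewrite lt_max hx orbT.
elim: n => [|n IH] s ts Ws; first by apply: base => //; lra.
pose r := Num.max t0 (s * expR (Q1 p * (- (2 * Q1 p)^-1))).
have s0 := lt_le_trans t0_gt0 ts.
have e : W (s * expR (Q1 p * (- (2 * Q1 p)^-1))) = W s - (2 * Q1 p)^-1 by rewrite W_scale.
have Qe : Q1 p * (2 * Q1 p)^-1 = 2^-1 by rewrite invfM mulrCA divff ?mulr1// lt0r_neq0.
have rs : r <= s.
  rewrite /r ge_max ts/= ger_pMr// -[leRHS]expR0 ler_expR mulrN Qe; lra.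
have tr : t0 <= r by rewrite /r le_max lexx.
have s'0 : 0 < s * expR (Q1 p * (- (2 * Q1 p)^-1)) by rewrite mulr_gt0 ?expR_gt0.
have [h|h] := leP t0 (s * expR (Q1 p * (- (2 * Q1 p)^-1))).
  have rE : r = s * expR (Q1 p * (- (2 * Q1 p)^-1)) by rewrite /r max_r.
  apply: (full_mass_step tr rs); rewrite rE.
    by rewrite e opprB addrC subrK Qe.
  by apply: IH => //; rewrite e mulrBr mulrBr Qe; move: Ws; rewrite -natr1 mulrBr; lra.
apply: base => //; have := W_le hp s'0 (ltW h); rewrite e => h'.
have : Q1 p * (W s - (2 * Q1 p)^-1) <= Q1 p * W t0 by rewrite ler_wpM2l// ltW.
rewrite !mulrBr Qe; lra.
Qed.

Lemma limit_exists : exists F, admissible F /\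
  forall t x, t0 <= t -> dist (F t) x = limdist t x.
Proof.
have /choice[F h] : forall t, exists P : probability R R, t0 <= t -> dist P =1 limdist t.
  move=> t; have [tt|tt] := pselect (t0 <= t); last by exists P0 => /tt.
  suff [P h] : exists P : probability R R, dist P =1 limdist t by exists P.
  apply: exists_prob.
  - by move=> x y; exact: le_limdist.
  (* One window covers all the points [x + k.+1%:R^-1], so right continuity is that of a single
     iterate. *)
  - move=> x; have [n xn] := window (x + 1).
    have e y : y <= x + 1 -> limdist t y = dist (Fn n t) y.
      by move=> yx; apply: limdistE => //; exact: le_lt_trans xn.
    rewrite e ?lerDl//; apply: eq_cvgn (@dist_right_cvg _ (Fn n t) x) => k.
    by rewrite e// lerD2l invf_le1// ler1n.
  - move=> x x0; rewrite (@limdistE 0) ?mul1r//; last exact: lt_trans c0.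
    by rewrite (aFn 0).2//; exact: lt_trans c0.
  - by move=> x; exact: limdist_le1.
  - exact: full_mass_all.
exists F; split; last by move=> t x tt; rewrite h.
have Fc u : t0 <= u -> supp_ge c (F u).
  by move=> tu x xc; rewrite h// (@limdistE 0) ?mul1r// (aFn 0).2.
split => // b; split => [u /andP[tu _]|u v x tu uv vb].
  exact: supp_geW (ltW c0) (Fc _ tu).
have tv := le_trans tu uv; have [n xn] := window x.
by rewrite !h// !(limdistE _ xn)//; have [_] := (aFn n).1 b; apply.
Qed.

Lemma limit_step F : admissible F ->
  (forall t x, t0 <= t -> dist (F t) x = limdist t x) -> step F F.
Proof.
move=> aF hF t x tt; have [n xn] := window x; have xn' := windowW (leqnSn n) xn.
rewrite (hF t x tt) (limdistE tt xn') (sFn n x tt); suff -> : rhs (Fn n) t x = rhs F t x by [].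
rewrite /rhs; suff -> : wI t0 t (gain (Fn n) x) = wI t0 t (gain F x) by [].
apply: eq_wI => v /andP[tv _].
apply: (gain1_agree hp c0 ((aFn _).2 v tv) (aF.2 v tv) _ xn') => y yn.
by rewrite hF// (limdistE tv yn).
Qed.

End limit.

(** Once [rhs] is negative it stays so, and restarting from the value 0 gives 0 as well; as long as
    it is nonnegative at [s], additivity of the integral suffices. *)
Lemma step_fp F : admissible F -> step F F -> forall b, fp hp t0 b F.
Proof.
move=> aF sF b; split=> [|s t x ts st tb]; first by case: aF.
have tt := le_trans ts st; rewrite !sF//.
have /andP[_ h] := rhs_incr x aF ts st.
have gF := aF.1 t.
have e : rhs F t x = rhs F s x + (wI s t (gain F x) - (W t - W s)).
  rewrite /rhs (wI_gain_split hp t0_gt0 gF x (lexx _) ts st)//; ring.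
have /andP[_ h1] := wI_gain_le_W hp F x (lt_le_trans t0_gt0 ts) st.
case: (leP 0 (rhs F s x)) => hs; first by rewrite e addrA.
by rewrite [LHS]max_l ?[RHS]max_l//; lra.
Qed.

Lemma fp_exists : exists F, (forall b, fp hp t0 b F) /\ dist (F t0) =1 dist P0.
Proof.
have [Fn [aFn sFn]] := iterates_exist.
have [F [aF hF]] := limit_exists aFn sFn.
have sF := limit_step aFn sFn aF hF.
exists F; split; first exact: step_fp.
by move=> x; rewrite sF// rhs_t0// max_r// dist_ge0.
Qed.

End existence.

(** * From the fixed-point equation to weak solutions *)

Section linear_equation.
Context {R : realType}.
Variables (p : nat -> R) (hp : coag_weights p).
Implicit Types (F : R -> probability R R).
Local Notation wI := (wI p).
Local Notation W := (W p).
Local Notation gain := (gain hp).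

Definition net F (x u : R) := gain F x u - below x (minp (F u)).

(* The loss term is the rate at which the clusters of minimal size are consumed;
   [fp] is its integrated form, the total loss up to time [t] being [W t - W s]
   until no cluster of size at most [x] is left. *)
Definition lin a b F := good a b F /\ forall s t x, a <= s -> s <= t -> t <= b ->
  dist (F t) x - dist (F s) x = wI s t (net F x).

Section good_path.
Variables (a b : R) (a0 : 0 < a) (F : R -> probability R R) (gF : good a b F).

Lemma below_minp_noninc x u v : a <= u -> u <= v -> v <= b ->
  below x (minp (F v)) <= below x (minp (F u)).
Proof.
move=> au uv vb; have := good_le_minp gF au uv vb => muv.
have [mv|mv] := leP (minp (F v)) x; last by rewrite (below0 mv) /below ler0n.
by rewrite !below1//; exact: le_trans mv.
Qed.

Lemma below_minp_measurable x s t : a <= s -> s <= t -> t <= b ->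
  measurable_fun `[s, t]%classic (fun u => below x (minp (F u))).
Proof.
move=> as_ st tb; apply: noninc_on_measurable => // u v su uv vt.
by apply: below_minp_noninc => //; [exact: le_trans su|exact: le_trans tb].
Qed.

Lemma net_measurable x s t : a <= s -> s <= t -> t <= b ->
  measurable_fun `[s, t]%classic (net F x).
Proof.
move=> as_ st tb; apply: measurable_funB; first exact: (gain_measurable hp gF).
exact: below_minp_measurable.
Qed.

Lemma net_bound x u : `|net F x u| <= 2.
Proof.
apply: le_trans (ler_normB _ _) _.
by apply: lerD; [exact: gain_bound|exact: below_bound].
Qed.

Lemma wI_net x s t : a <= s -> s <= t -> t <= b ->
  wI s t (net F x) = wI s t (gain F x) - wI s t (fun u => below x (minp (F u))).
Proof.
move=> as_ st tb; apply: (@wIB _ _ hp _ _ _ _ _ 1).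
- exact: lt_le_trans as_.
- exact: (gain_measurable hp gF).
- exact: below_minp_measurable.
- by move=> u _; exact: gain_bound.
- by move=> u _; exact: below_bound.
Qed.

End good_path.

(** If mass at or below [x] is left at [t], the min was at most [x] all along and the loss is
    exactly [W t - W s]. If none is left, the loss is at most that, and the maximum is 0. *)
Lemma lin_fp a b F : 0 < a -> lin a b F -> fp hp a b F.
Proof.
move=> a0 [gF h]; split=> // s t x as_ st tb; have s0 := lt_le_trans a0 as_.
have := h s t x as_ st tb; rewrite (wI_net a0 gF)// => e.
have one : wI s t (fun=> 1) = W t - W s by rewrite (wI_cst hp)// mul1r.
have B : wI s t (fun u => below x (minp (F u))) <= W t - W s.
  rewrite -one; apply: (@le_wI _ _ hp _ _ s0 _ _ 1) => // u _.
  - exact: below_bound.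
  - by rewrite normr1.
  - by have := below_bound x (minp (F u)); rewrite ler_norml => /andP[].
have tab : a <= t <= b by rewrite (le_trans as_).
have [t00|t0] := eqVneq (dist (F t) x) 0.
  by rewrite t00 max_l//; lra.
have mt : minp (F t) <= x.
  by apply: minp_le; [apply: gF.1|rewrite lt0r t0 dist_ge0].
have B1 : wI s t (fun u => below x (minp (F u))) = W t - W s.
  rewrite -one; apply: eq_wI => u /andP[su ut]; rewrite below1//.
  apply: le_trans mt; apply: (good_le_minp gF) => //; exact: le_trans su.
by rewrite B1 in e; rewrite max_r; have := dist_ge0 (F t) x; lra.
Qed.

Section fp_lin.
Variables (a b : R) (a0 : 0 < a) (F : R -> probability R R) (fpF : fp hp a b F).
Let gF : good a b F. Proof. by case: fpF. Qed.

(** By right continuity some level [x + d] has a mass at [u] so small that it is gone by time [v];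
    hence the strict inequality. *)
Lemma fp_dist0_minp x u v : a <= u -> u < v -> v <= b -> dist (F u) x = 0 ->
  x < minp (F v).
Proof.
move=> au uv vb ux; have u0 := lt_le_trans a0 au; have Wuv := W_lt hp u0 uv.
pose e := Num.min 2^-1 ((W v - W u) / 2).
have e0 : 0 < e by rewrite /e lt_min; apply/andP; split; lra.
have e1 : e <= 2^-1 by rewrite /e ge_min lexx.
have e2 : 2 * e <= W v - W u.
  have : e <= (W v - W u) / 2 by rewrite /e ge_min lexx orbT.
  lra.
have [d d0 hd] := dist_right (F u) x e0; rewrite ux add0r in hd.
have vanish := fp_vanish a0 fpF au (ltW uv) vb (ltW hd) e1 e2.
have Fv : supp_ge 0 (F v) by apply: gF.1; rewrite vb (le_trans au)// ltW.
apply: (@lt_le_trans _ _ (x + d)); first by rewrite ltrDl.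
rewrite leNgt; apply/negP => /(dist_gt0 Fv); rewrite vanish ltxx//.
Qed.

Lemma fp_lipschitz x s t : a <= s -> s <= t -> t <= b ->
  dist (F s) x + wI s t (gain F x) - (W t - W s) <= dist (F t) x.
Proof. by move=> as_ st tb; rewrite (fpF.2 s t x)// le_max lexx orbT. Qed.

Lemma net_eq0 x u : a <= u <= b -> x < minp (F u) -> net F x u = 0.
Proof.
move=> uab xm; have Fu := gF.1 u uab; rewrite /net (below0 xm) subr0.
apply/eqP; rewrite eq_le gain1_ge0 andbT.
by rewrite (le_trans (gain1_le hp x Fu))// (supp_ge_minp Fu xm).
Qed.

Lemma wI_net_eq0 x s t : a <= s -> s <= t -> t <= b ->
  (forall u, s < u <= t -> x < minp (F u)) -> wI s t (net F x) = 0.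
Proof.
move=> as_ st tb h; rewrite -[RHS](mul0r (W t - W s)) -(wI_cst hp)//; last exact: lt_le_trans as_.
apply: (eq_wI_oo hp (lt_le_trans a0 as_) (net_measurable gF x as_ st tb)) => //.
move=> u /andP[su ut]; apply: net_eq0.
  by rewrite (le_trans as_ (ltW su)) (le_trans (ltW ut)).
by apply: h; rewrite su ltW.
Qed.

(* Before [r] every cluster of minimal size is at most [x] and after [r] none is. *)
Lemma fp_lin : lin a b F.
Proof.
split=> // s t x as_ st tb; have s0 := lt_le_trans a0 as_.
have sab : a <= s <= b by rewrite as_ (le_trans st).
have tab : a <= t <= b by rewrite tb (le_trans as_).
have [ms|sx] := ltP x (minp (F s)).
  rewrite wI_net_eq0//; last first.
    move=> u /andP[su ut]; apply: (lt_le_trans ms).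
    exact: (good_le_minp gF as_ (ltW su) (le_trans ut tb)).
  have xt : x < minp (F t) by apply: (lt_le_trans ms); exact: (good_le_minp gF).
  by rewrite (supp_ge_minp (gF.1 s sab) ms) (supp_ge_minp (gF.1 t tab) xt) subrr.
pose A := [set u | s <= u <= t /\ minp (F u) <= x].
have As : A s by split; rewrite // lexx.
have supA : has_sup A by split; [exists s|exists t => u [/andP[]]].
pose r := sup A.
have sr : s <= r by apply: ub_le_sup => //; exact: supA.2.
have rt : r <= t by apply: ge_sup => [|u [/andP[]]//]; exists s.
have ar := le_trans as_ sr; have rb := le_trans rt tb; have r0 := lt_le_trans s0 sr.
(* Whether the min is at most [x] at [r] itself is undecided, but every time before [r] is followed
   by one, up to [r], where it is. *)
have before u : s <= u -> u < r -> exists2 v, u < v <= r & minp (F v) <= x.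
  move=> su; rewrite -subr_gt0 => ur; have [v Av] := sup_adherent ur supA.
  rewrite opprB addrC subrK => uv; exists v; last exact: Av.2.
  by rewrite uv ub_le_sup//; exact: supA.2.
have after u : r < u <= t -> x < minp (F u).
  move=> /andP[ru ut]; rewrite ltNge; apply/negP => mu.
  have : u <= r by apply: ub_le_sup; [exact: supA.2|split; rewrite // ut (le_trans sr) ?ltW].
  by rewrite leNgt ru.
rewrite (@wI_split _ _ hp s r t _ 2)//; last 2 first.
- exact: (net_measurable gF).
- by move=> u _; exact: net_bound.
rewrite (wI_net_eq0 ar rt tb after) addr0.
have -> : wI s r (net F x) = wI s r (gain F x) - (W r - W s).
  rewrite (wI_net a0 gF)//; congr (_ - _).
  rewrite -[RHS]mul1r -(wI_cst hp)//.
  apply: (eq_wI_oo hp s0 (below_minp_measurable gF x as_ sr rb)) => //.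
  move=> u /andP[su ur]; have [v /andP[uv vr] mv] := before u (ltW su) ur.
  rewrite below1//; apply: le_trans mv; apply: (good_le_minp gF).
  - exact: le_trans (ltW su).
  - exact: ltW.
  - exact: le_trans rb.
(* The positive part is inactive up to [r]. At [u < r] the mass is positive by [fp_dist0_minp]; [u]
   is taken within W-time [e] of [r], as the mass at [r] may be 0. *)
have Er : dist (F r) x = dist (F s) x + wI s r (gain F x) - (W r - W s).
  rewrite (fpF.2 s r x)// max_r//; apply/ler_addgt0Pr => e e0.
  pose u := Num.max s (r * expR (Q1 p * - e)).
  have ur' : r * expR (Q1 p * - e) < r.
    by rewrite gtr_pMr// -[ltRHS]expR0 ltr_expR mulrN oppr_lt0 mulr_gt0// (Q1_gt0 hp).
  have su : s <= u by rewrite /u le_max lexx.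
  have Wu : W r - W u <= e.
    have : W (r * expR (Q1 p * - e)) <= W u.
      by apply: (W_le hp); [rewrite mulr_gt0 ?expR_gt0|rewrite /u le_max lexx orbT].
    by rewrite W_scale//; lra.
  have ru : u <= r by rewrite /u ge_max sr ltW.
  have [ru'|ru'] := eqVneq u r.
    have rs : r = s by move: ru'; rewrite /u; case: leP => // _ rr; rewrite rr ltxx in ur'.
    have := wI_gain_le_W hp F x s0 (lexx s); rewrite rs.
    by have := dist_ge0 (F s) x; lra.
  have ur : u < r by rewrite lt_neqAle ru' ru.
  have [v /andP[uv vr] mv] := before u su ur.
  have fu : 0 < dist (F u) x.
    rewrite lt0r dist_ge0 andbT; apply/eqP => fu0.
    have := fp_dist0_minp (le_trans as_ su) uv (le_trans vr rb) fu0; lra.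
  have := fpF.2 s u x as_ su (le_trans ru rb).
  case: (leP 0 (dist (F s) x + wI s u (gain F x) - (W u - W s))) => hu fe; last first.
    by rewrite fe ltxx in fu.
  rewrite (wI_gain_split hp a0 gF x as_ su ru rb).
  have := wI_gain_le_W hp F x (lt_le_trans s0 su) ru; lra.
(* If [r < t], no mass at or below [x] is left at [v] just after [r]; as mass is lost at rate at
   most 1, none was left at [r] either. *)
suff -> : dist (F t) x = dist (F r) x by rewrite Er; ring.
have [->//|rt'] := eqVneq t r.
have lt_rt : r < t by rewrite lt_neqAle eq_sym rt' rt.
have ft : dist (F t) x = 0.
  by apply: (supp_ge_minp (gF.1 t tab)); apply: after; rewrite lt_rt lexx.
rewrite ft; apply/esym/dist_le0/ler_addgt0Pr => e e0; rewrite add0r.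
pose v := Num.min t (r * expR (Q1 p * e)).
have rv : r < v.
  by rewrite /v lt_min lt_rt/= ltr_pMr// -[ltLHS]expR0 ltr_expR mulr_gt0// (Q1_gt0 hp).
have vt : v <= t by rewrite /v ge_min lexx.
have Wv : W v - W r <= e.
  have : W v <= W (r * expR (Q1 p * e)).
    by apply: (W_le hp); [exact: lt_trans rv|rewrite /v ge_min lexx orbT].
  by rewrite W_scale//; lra.
have fv : dist (F v) x = 0.
  apply: supp_ge_minp; first by apply: gF.1; rewrite (le_trans ar (ltW rv)) (le_trans vt).
  by apply: after; rewrite rv.
have := fp_lipschitz x ar (ltW rv) (le_trans vt tb).
have := wI_gain_le_W hp F x r0 (ltW rv); rewrite fv; lra.
Qed.

End fp_lin.

End linear_equation.

(** * Step approximation of test functions *)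

Section test_functions.
Context {R : realType}.
Implicit Types (a g : R -> R).

Lemma C0_bounded a : C0 a -> exists M : R, forall y, 0 <= y -> `|a y| <= M.
Proof.
move=> [ca a0]; have /cvgrPdist_lt /(_ _ (ltr01 : 0 < 1 :> R))[X [_ hX]] := a0.
pose X' := Num.max 0 X.
have X0 : 0 <= X' by rewrite /X' le_max lexx.
have cX : {within `[0, X'], continuous (fun y => `|a y|)}.
  have c1 : {within `[0, X'], continuous a}.
    by apply: continuous_subspaceW ca; apply: subset_itvl.
  move=> y; apply: cvg_norm; exact: c1.
have [d _ hd] := EVT_max X0 cX.
exists (Num.max 1 `|a d|) => y y0; rewrite le_max.
have [yX|Xy] := leP y X'; first by rewrite hd ?orbT// in_itv/= y0.
have /hX : X < y by apply: le_lt_trans Xy; rewrite /X' le_max lexx orbT.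
by rewrite sub0r normrN => /ltW ->.
Qed.

Lemma C0_continuous a y e : C0 a -> 0 <= y -> 0 < e ->
  exists2 d, 0 < d & forall z, 0 <= z -> `|z - y| < d -> `|a z - a y| < e.
Proof.
move=> [ca _] y0 e0; have y0' : `[0, +oo[%classic y by rewrite /= in_itv/= y0.
have /cvgrPdist_lt /(_ _ e0) := (subspace_continuousP _ a).1 ca y y0'.
rewrite near_withinE => /nbhs_ballP[d /= d0 hd]; exists d => // z z0 zy.
by rewrite distrC; apply: hd; rewrite /ball/= ?in_itv/= ?andbT// distrC.
Qed.

(** The grid has mesh [1/(m+1)] and reaches up to [m+1], so it becomes fine and long together; the
    value 0 at its end closes the telescoping sum. *)
Definition step_coef a m i : R :=
  if (i < m.+1 * m.+1)%N then a (i%:R / m.+1%:R) else 0.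

(* On [ [0, m+1] ] this is [a] at the least multiple of [1/(m+1)] above the argument. *)
Definition step_approx a m y : R :=
  \sum_(0 <= i < m.+1 * m.+1)
     (step_coef a m i - step_coef a m i.+1) * below (i%:R / m.+1%:R) y.

(** Summation by parts: the functions [below (i%:R / m.+1%:R)] equal 1 at [y] exactly from the least
    grid index [k] above [y] on. Only for [k = 0], when [y] is nonpositive, can the grid point be
    far from [y]. *)
Lemma step_approxE a m y : exists2 k : nat,
  step_approx a m y = step_coef a m k &
  y <= k%:R / m.+1%:R /\ (k = 0%N \/ k%:R / m.+1%:R < y + m.+1%:R^-1).
Proof.
have exk : exists k : nat, y <= k%:R / m.+1%:R.
  exists (Num.truncn (y * m.+1%:R)).+1.
  by rewrite ler_pdivlMr// ltW// truncnS_gt.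
case: (ex_minnP exk) => k yk kmin; exists k; last first.
  split=> //; case: k yk kmin => [|k] yk kmin; [by left|right].
  have : k%:R / m.+1%:R < y by rewrite ltNge; apply/negP => /kmin; rewrite ltnn.
  have -> : k.+1%:R / m.+1%:R = k%:R / m.+1%:R + m.+1%:R^-1 :> R.
    by rewrite -[k.+1%:R]natr1 mulrDl mul1r.
  by rewrite ltrD2r.
rewrite /step_approx; set N := (m.+1 * m.+1)%N.
have e i : below (i%:R / m.+1%:R) y = (k <= i)%N%:R.
  have [ki|ik] := leqP k i.
    by rewrite below1//; apply: le_trans yk _; rewrite ler_pM2r ?invr_gt0// ler_nat.
  by rewrite below0// ltNge; apply/negP => /kmin; rewrite leqNgt ik.
under eq_bigr do rewrite e.
have [Nk|kN] := leqP N k.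
  rewrite /step_coef -/N ltnNge Nk/= big_nat big1// => i /andP[_ iN].
  by rewrite (leqNgt k) (leq_trans iN Nk)/= mulr0.
rewrite (big_cat_nat (n := k))//=; last exact: ltnW.
rewrite [X in X + _]big_nat big1 ?add0r; last first.
  by move=> i /andP[_ ik]; rewrite (leqNgt k) ik/= mulr0.
rewrite (@telescope_sumr_eq _ _ _ (fun i => - step_coef a m i)); last first.
- by move=> i /andP[ki _]; rewrite ki/= mulr1 opprK addrC.
- exact: ltnW.
by rewrite /step_coef -/N ltnn kN oppr0 add0r opprK.
Qed.

Lemma step_approx_bound a (M : R) m y : 0 <= M -> (forall y, 0 <= y -> `|a y| <= M) ->
  `|step_approx a m y| <= M.
Proof.
move=> M0 aM; have [k -> _] := step_approxE a m y.
by rewrite /step_coef; case: ifP => _; rewrite ?normr0// aM// divr_ge0.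
Qed.

Lemma step_approx_cvg a y : C0 a -> step_approx a m y @[m --> \oo] --> a (Num.max 0 y).
Proof.
move=> Ca; apply/cvgrPdist_lt => e e0; set y' := Num.max 0 y.
have y'0 : 0 <= y' by rewrite /y' le_max lexx.
have [d d0 hd] := C0_continuous Ca y'0 e0.
(* From [M] on the mesh is below [d], and [y' < m%:R] keeps the index [k] inside the grid. *)
pose M := maxn (Num.truncn d^-1) (Num.truncn y').+1.
exists M => // m /=; rewrite geq_max => /andP[dm ym].
have md : m.+1%:R^-1 < d.
  rewrite -[ltRHS]invrK ltf_pV2 ?posrE ?invr_gt0//.
  by apply: lt_le_trans (truncnS_gt d^-1) _; rewrite ler_nat.
have ym' : y' < m%:R by apply: lt_le_trans (truncnS_gt y') _; rewrite ler_nat.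
have m0 : 0 < m.+1%:R^-1 :> R by rewrite invr_gt0.
have [k -> [yk hk]] := step_approxE a m y.
have ky : y' <= k%:R / m.+1%:R < y' + m.+1%:R^-1.
  rewrite {1}/y' ge_max yk divr_ge0//=; case: hk => [->|hk]; first by rewrite mul0r ltr_pwDr.
  by apply: lt_le_trans hk _; rewrite lerD2r /y' le_max lexx orbT.
have /andP[ky1 ky2] := ky.
rewrite /step_coef ifT.
  rewrite distrC; apply: hd; first exact: le_trans ky1.
  by rewrite ger0_norm ?subr_ge0// ltrBlDl (lt_trans ky2)// ltrD2l.
rewrite -(ltr_nat R) natrM -ltr_pdivrMr//.
have m1 : m.+1%:R^-1 <= 1 :> R by rewrite invf_le1// ler1n.
have mS : m.+1%:R = m%:R + 1 :> R by rewrite natr1.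
by rewrite [ltRHS]mS (lt_le_trans ky2)// lerD// ltW.
Qed.

End test_functions.

Section fp_test.
Context {R : realType}.
Variables (p : nat -> R) (hp : coag_weights p).
Implicit Types (F : R -> probability R R) (f g : R -> R).
Local Notation wI := (wI p).
Local Notation W := (W p).
Local Notation mix := (mixture hp).

Definition mean F g t := \int[F t]_(y in setT) g y.

Definition rate F g u :=
  \int[mix (F u)]_(y in setT) g (minp (F u) + y) - g (minp (F u)).

(** [g] is a bounded measurable stand-in for [a] on the nonnegative reals; with it the series over
    [k] becomes one integral against the mixture. *)
Lemma coag_rateE F a g u : supp_ge 0 (F u) -> bmeas g ->
  (forall y, 0 <= y -> a y = g y) -> coag_rate p F a u = rate F g u.
Proof.
move=> F0 bg ag; have m0 := minp_ge0 F0; set l := minp (F u) in m0 *.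
have bgl := bmeas_shift l bg.
have bc : bmeas (fun _ : R => g l) by split => //; exists `|g l|.
have bh : bmeas (fun y => g (l + y) - g l).
  have [mg [M gM]] := bgl; split; first exact: measurable_funB.
  by exists (M + `|g l|) => y; rewrite (le_trans (ler_normB _ _))// lerD2r.
have -> : rate F g u = \int[mix (F u)]_(y in setT) (g (l + y) - g l).
  by rewrite /rate -/l RintegralB_prob// Rintegral_prob_cst.
apply/cvg_lim => //.
apply: eq_cvgn (@cvg_mixture_integral _ _ hp (F u) _ bh) => n.
apply: eq_bigr => k _; rewrite -iter_int_convn//; congr (_ * _).
by apply: eq_iter_int => // y y0; rewrite !ag// addr_ge0.
Qed.

Lemma rate_bound F g (M : R) u : (forall y, `|g y| <= M) -> `|rate F g u| <= M + M.
Proof.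
move=> gM; apply: le_trans (ler_normB _ _) _; apply: lerD => //.
exact: Rintegral_prob_le.
Qed.

(** Identifies [lin] with the weak equation tested against [below x]. *)
Lemma rate_below F x u : rate F (below x) u = net hp F x u.
Proof.
rewrite /rate /net /gain /gain1 dist_Rintegral; congr (_ - _).
by apply: eq_Rintegral => y _; rewrite /below lerBrDl.
Qed.

Section class.
Variables (s t : R) (s0 : 0 < s) (st : s <= t) (F : R -> probability R R).
Hypothesis linF : lin hp s t F.
Let gF : good s t F. Proof. by case: linF. Qed.

(** With measurability in time included, the class is stable under linear combinations and bounded
    pointwise limits, and thus grows from the functions [below x] to all of [C0]. *)
Definition balanced g := [/\ bmeas g, measurable_fun `[s, t]%classic (mean F g),
  measurable_fun `[s, t]%classic (rate F g) &
  mean F g t - mean F g s = wI s t (rate F g)].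

Lemma balanced_below x : balanced (below x).
Proof.
have e u : mean F (below x) u = dist (F u) x by rewrite dist_Rintegral.
have eJ : rate F (below x) = net hp F x by apply/funext => u; rewrite rate_below.
split; first exact: bmeas_below.
- apply: noninc_on_measurable => // u v su uv vt; rewrite !e; exact: gF.2.
- by rewrite eJ; exact: (net_measurable hp gF).
- by rewrite !e eJ; apply: linF.2.
Qed.

Lemma bmeas_lin (k : R) f g : bmeas f -> bmeas g -> bmeas (fun y => k * f y + g y).
Proof.
move=> [mf [M fM]] [mg [N gN]]; split.
  by apply: measurable_funD => //; exact: measurable_funM.
exists (`|k| * M + N) => y; rewrite (le_trans (ler_normD _ _))// lerD// normrM.
by rewrite ler_wpM2l.
Qed.

Lemma Rintegral_prob_lin (P : probability R R) (k : R) f g : bmeas f -> bmeas g ->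
  \int[P]_(y in setT) (k * f y + g y) =
  k * \int[P]_(y in setT) f y + \int[P]_(y in setT) g y.
Proof.
move=> bf bg; have fi := bmeas_integrable P bf; have gi := bmeas_integrable P bg.
rewrite -RintegralZl// -RintegralD//.
by apply: (integrableZl _ _ fi).
Qed.

Lemma balanced_lin (k : R) f g : balanced f -> balanced g ->
  balanced (fun y => k * f y + g y).
Proof.
move=> [bf Ef Jf ef] [bg Eg Jg eg].
have E u : mean F (fun y => k * f y + g y) u = k * mean F f u + mean F g u.
  exact: Rintegral_prob_lin.
have J : rate F (fun y => k * f y + g y) = (fun u => k * rate F f u + rate F g u).
  apply/funext => u; rewrite /rate (Rintegral_prob_lin _ _ (bmeas_shift _ bf) (bmeas_shift _ bg)).
  by ring.
split; first exact: bmeas_lin.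
- rewrite (_ : mean F _ = (fun u => k * mean F f u + mean F g u)); last exact/funext.
  by apply: measurable_funD => //; exact: measurable_funM.
- by rewrite J; apply: measurable_funD => //; exact: measurable_funM.
- have [_ [M fM]] := bf; have [_ [N gN]] := bg.
  have M0 := le_trans (normr_ge0 _) (fM 0); have N0 := le_trans (normr_ge0 _) (gN 0).
  rewrite J (@wI_lin _ _ hp _ _ s0 _ _ _ ((M + M) + (N + N)))//.
  + by rewrite !E -ef -eg; ring.
  + by move=> u _; apply: le_trans (rate_bound _ _ fM) _; lra.
  + by move=> u _; apply: le_trans (rate_bound _ _ gN) _; lra.
Qed.

Lemma balanced_sum (N : nat) (k x : nat -> R) :
  balanced (fun y => \sum_(0 <= i < N) k i * below (x i) y).
Proof.
elim: N => [|N IH].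
  have -> : (fun y : R => \sum_(0 <= i < 0) k i * below (x i) y) =
      (fun y => (- 1) * below 0 y + below 0 y).
    by apply/funext => y; rewrite big_geq// mulN1r addNr.
  by apply: balanced_lin; exact: balanced_below.
have -> : (fun y => \sum_(0 <= i < N.+1) k i * below (x i) y) =
    (fun y => k N * below (x N) y + \sum_(0 <= i < N) k i * below (x i) y).
  by apply/funext => y; rewrite big_nat_recr//= addrC.
by apply: balanced_lin => //; exact: balanced_below.
Qed.

Lemma balanced_cvg (g_ : nat -> R -> R) g (M : R) : (forall n, balanced (g_ n)) ->
  (forall n y, `|g_ n y| <= M) -> (forall y, g_ n y @[n --> \oo] --> g y) -> balanced g.
Proof.
move=> bg gM gg.
have mg n : measurable_fun setT (g_ n) by have [[]] := bg n.
have bgl : bmeas g.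
  split; first by apply: (measurable_fun_cvg mg) => y _.
  exists M => y; have c : `|g_ n y| @[n --> \oo] --> `|g y| by apply: cvg_norm; exact: gg.
  exact: (cvgn_le c (cvg_cst M)).
have cE u : mean F (g_ n) u @[n --> \oo] --> mean F g u.
  exact: (@cvg_Rintegral_prob _ _ _ (F u) _ _ M).
have cJ u : rate F (g_ n) u @[n --> \oo] --> rate F g u.
  apply: cvgB; last exact: gg.
  apply: (@cvg_Rintegral_prob _ _ _ (mix (F u)) _ _ M) => // n.
  by apply: measurableT_comp => //; exact: measurable_funD.
split => //.
- by apply: (@measurable_fun_cvg _ _ _ _ (fun n => mean F (g_ n))) => [n|u _]; [have [] := bg n|exact: cE].
- by apply: (@measurable_fun_cvg _ _ _ _ (fun n => rate F (g_ n))) => [n|u _]; [have [] := bg n|exact: cJ].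
- have c1 : mean F (g_ n) t - mean F (g_ n) s @[n --> \oo] --> mean F g t - mean F g s.
    by apply: cvgB; exact: cE.
  have c2 : wI s t (rate F (g_ n)) @[n --> \oo] --> wI s t (rate F g).
    apply: (@wI_cvg _ _ hp _ _ s0 _ _ (M + M)) => [n|n u _|u _].
    + by have [] := bg n.
    + exact: rate_bound.
    + exact: cJ.
  have c3 : mean F (g_ n) t - mean F (g_ n) s @[n --> \oo] --> wI s t (rate F g).
    by apply: eq_cvgn c2 => n; have [_ _ _ ->] := bg n.
  exact: (cvg_unique _ c1 c3).
Qed.

Lemma balanced_C0 a : C0 a -> balanced (fun y => a (Num.max 0 y)).
Proof.
move=> Ca; have [M aM] := C0_bounded Ca.
have M0 : 0 <= M by exact: le_trans (normr_ge0 _) (aM 0 (lexx _)).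
apply: (@balanced_cvg (step_approx a) _ M) => [n|n y|y].
- exact: balanced_sum.
- exact: step_approx_bound.
- exact: step_approx_cvg.
Qed.

End class.

Lemma mean_ext F a u : supp_ge 0 (F u) ->
  \int[F u]_(y in setT) a y = mean F (fun y => a (Num.max 0 y)) u.
Proof. by move=> F0; apply: (eq_Rintegral_supp F0) => y y0; rewrite max_r. Qed.

Lemma lin_weak_solution t0 F : 0 < t0 -> (forall b, lin hp t0 b F) ->
  0 < minp (F t0) -> weak_solution p `[t0, +oo[%classic F.
Proof.
move=> t00 linF mF.
have Jt t : `[t0, +oo[%classic t = (t0 <= t) by rewrite /= in_itv/= andbT.
have F0 t : t0 <= t -> supp_ge 0 (F t).
  by move=> tt; apply: (linF t).1.1; rewrite tt lexx.
have sub s t : t0 <= s -> lin hp s t F.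
  move=> ts; have [[g1 g2] h] := linF t; split; last first.
    by move=> u v x su; apply: h; exact: le_trans su.
  split=> [u /andP[su ut]|u v x su]; last by apply: g2; exact: le_trans su.
  by apply: g1; rewrite ut (le_trans ts).
split; [|split; [|split; [|split]]].
- by move=> t; rewrite Jt => tt; apply/on_RplusP/F0.
- move=> a Ca; rewrite itv_bndy_bigcup_BRight; apply/measurable_fun_bigcup => // n.
  have tn : t0 <= t0 + n%:R by rewrite lerDl.
  have [_ + _ _] := balanced_C0 t00 tn (sub _ _ (lexx t0)) Ca.
  apply: eq_measurable_fun => u; rewrite inE/= in_itv/= => /andP[tu _].
  by rewrite mean_ext//; exact: F0.
- move=> t; rewrite Jt => tt; apply: lt_le_trans mF _.
  exact: (good_le_minp (linF t).1).
- move=> s t; rewrite !Jt => ts tt st; exact: (good_le_minp (linF t).1).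
- move=> a Ca s t; rewrite !Jt => ts tt st; have s0 := lt_le_trans t00 ts.
  have [bg _ _ e] := balanced_C0 s0 st (sub _ _ ts) Ca.
  rewrite !mean_ext; [|exact: F0..]; rewrite e; apply: eq_wI => u /andP[su ut].
  rewrite (coag_rateE (F0 u (le_trans ts su)) bg)// => y y0; by rewrite max_r.
Qed.

End fp_test.

(** * From weak solutions to the fixed-point equation *)

Section tent.
Context {R : realType}.
Implicit Types (x y : R) (n : nat).

(** A continuous stand-in for [below x], squeezed between [below x] and [below (x + n.+1%:R^-1)]. *)
Definition tent x n y : R := Num.max 0 (Num.min 1 (1 - n.+1%:R * (y - x))).

Lemma tent_continuous x n : continuous (tent x n).
Proof.
pose l (y : R) := 1 - n.+1%:R * (y - x).
move=> y; apply: (@continuous_max _ _ (cst 0) (cst 1 \min l)); first exact: cvg_cst.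
apply: (@continuous_min _ _ (cst 1) l); first exact: cvg_cst.
apply: cvgB; first exact: cvg_cst.
apply: cvgM; first exact: cvg_cst.
by apply: cvgB; [exact: cvg_id|exact: cvg_cst].
Qed.

Lemma tent_bound x n y : `|tent x n y| <= 1.
Proof.
by rewrite ger0_norm /tent ?le_max ?lexx// ge_max ler01 ge_min lexx.
Qed.

Lemma bmeas_tent x n : bmeas (tent x n).
Proof.
split; last by exists 1; exact: tent_bound.
by apply: continuous_measurable_fun; exact: tent_continuous.
Qed.

Lemma below_le_tent x n y : below x y <= tent x n y.
Proof.
have [yx|xy] := leP y x; last by rewrite (below0 xy) /tent le_max lexx.
rewrite (below1 yx) /tent le_max le_min lexx/=; apply/orP; right.
by rewrite lerBrDr gerDl mulr_ge0_le0//; lra.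
Qed.

Lemma tent_eq0 x n y : x + n.+1%:R^-1 <= y -> tent x n y = 0.
Proof.
move=> xy; apply: max_l; rewrite ge_min; apply/orP; right.
by rewrite subr_le0 -ler_pdivrMl// mulr1 lerBrDl.
Qed.

Lemma tent_le_below x n y : tent x n y <= below (x + n.+1%:R^-1) y.
Proof.
have [yx|xy] := leP y (x + n.+1%:R^-1); last by rewrite (tent_eq0 (ltW xy)) ler0n.
by rewrite (below1 yx) (le_trans (ler_norm _))// tent_bound.
Qed.

Lemma tent_noninc x n y z : y <= z -> tent x n z <= tent x n y.
Proof.
move=> yz; rewrite /tent ge_max !le_max lexx/=; apply/orP; right.
rewrite le_min !ge_min lexx/=; apply/orP; right.
by rewrite lerB// ler_wpM2l// lerB.
Qed.

Lemma C0_tent x n : C0 (tent x n).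
Proof.
split; first by apply: continuous_subspaceT; exact: tent_continuous.
apply/cvgrPdist_lt => e e0.
exists (x + n.+1%:R^-1); split; first exact: num_real.
by move=> y xy; rewrite (tent_eq0 (ltW xy)) subrr normr0.
Qed.

Lemma below_right_cvg x y : below (x + n.+1%:R^-1) y @[n --> \oo] --> below x y.
Proof.
(* As a function of [z] this is the distribution function of a point mass, whose right continuity is
   known. *)
have e z : dist (dirac y) z = below z y.
  by rewrite dist_Rintegral dirac_Rintegral//; exact: bmeas_below.
rewrite -e; apply: eq_cvgn (@dist_right_cvg _ (dirac y) x) => n.
by rewrite e.
Qed.

End tent.

Section weak_lin.
Context {R : realType}.
Variables (p : nat -> R) (hp : coag_weights p).
Variables (J : set R) (a b : R) (a0 : 0 < a).
Hypothesis Jab : forall u, a <= u <= b -> J u.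
Variables (F : R -> probability R R) (wF : weak_solution p J F).
Local Notation wI := (wI p).
Local Notation W := (W p).
Local Notation mix := (mixture hp).

Let F0 u : a <= u <= b -> supp_ge 0 (F u).
Proof. by move=> /Jab Ju; apply/on_RplusP; have [h _] := wF; exact: h. Qed.

Let mF u v : a <= u -> u <= v -> v <= b -> minp (F u) <= minp (F v).
Proof.
move=> au uv vb; have [_ [_ [_ [h _]]]] := wF; apply: h => //; apply: Jab.
  by rewrite au (le_trans uv).
by rewrite vb (le_trans au).
Qed.

Let tent_balance x n s t : a <= s -> s <= t -> t <= b ->
  mean F (tent x n) t - mean F (tent x n) s = wI s t (rate hp F (tent x n)).
Proof.
move=> as_ st tb; have [_ [_ [_ [_ h]]]] := wF.
have Js : J s by apply: Jab; rewrite as_ (le_trans st).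
have Jt : J t by apply: Jab; rewrite tb (le_trans as_).
rewrite [LHS](h _ (C0_tent x n) s t Js Jt st); apply: eq_wI => u /andP[su ut].
rewrite (@coag_rateE _ _ hp F _ (tent x n))//; last exact: bmeas_tent.
by apply: F0; rewrite (le_trans as_) ?(le_trans ut).
Qed.

Let tent_squeeze x n u : dist (F u) x <= mean F (tent x n) u <= dist (F u) (x + n.+1%:R^-1).
Proof.
rewrite !dist_Rintegral; apply/andP; split; apply: (@le_Rintegral_prob _ _ _ _ _ _ 1) => y.
- exact: below_bound.
- exact: tent_bound.
- exact: below_le_tent.
- exact: tent_bound.
- exact: below_bound.
- exact: tent_le_below.
Qed.

Let mean_tent_cvg x u : mean F (tent x n) u @[n --> \oo] --> dist (F u) x.
Proof.
apply: (squeeze_cvgr _ (cvg_cst (dist (F u) x)) (@dist_right_cvg _ (F u) x)).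
by apply: nearW => n; exact: tent_squeeze.
Qed.

(** Against the nonincreasing [tent x n] the rate is nonpositive, since replacing the min by a
    larger size lowers the tent; then [n] grows. *)
Lemma weak_good : good a b F.
Proof.
split => // u v x au uv vb; have u0 := lt_le_trans a0 au.
apply: (cvgn_le (@mean_tent_cvg x v) (@mean_tent_cvg x u)) => n.
rewrite -subr_le0 (tent_balance _ _ au uv vb) -[leRHS](mul0r (W v - W u)) -(wI_cst hp)//.
apply: (@le_wI _ _ hp _ _ u0 _ _ 2) => [r _|r _|r /andP[ur rv]].
- by apply: le_trans (rate_bound hp F r (tent_bound x n)) _; rewrite -[2]/(1 + 1).
- by rewrite normr0.
have rab : a <= r <= b by rewrite (le_trans au ur) (le_trans rv).
rewrite /rate subr_le0 -[leRHS](Rintegral_prob_cst (mix (F r))).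
apply: (@le_Rintegral_supp _ 0 _ _ _ 1) => [|y|y|y y0]; try exact: tent_bound.
  by apply: supp_ge_mixture => //; exact: F0.
by apply: tent_noninc; rewrite lerDl.
Qed.

Lemma weak_lin : lin hp a b F.
Proof.
have gF := weak_good; split => // s t x as_ st tb; have s0 := lt_le_trans a0 as_.
have cl : mean F (tent x n) t - mean F (tent x n) s @[n --> \oo] --> dist (F t) x - dist (F s) x.
  by apply: cvgB; exact: mean_tent_cvg.
suff cr : mean F (tent x n) t - mean F (tent x n) s @[n --> \oo] --> wI s t (net hp F x).
  exact: (cvg_unique _ cl cr).
(* The rate of the tent lies between [lo] and [hi], whose integrals both tend to that of [net];
   comparing the integrals takes bounds only, not measurability of the tent rate. *)
pose lo n u := gain hp F x u - below (x + n.+1%:R^-1) (minp (F u)).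
pose hi n u := gain hp F (x + n.+1%:R^-1) u - below x (minp (F u)).
have bnd (y z u : R) : `|gain hp F y u - below z (minp (F u))| <= 2.
  apply: le_trans (ler_normB _ _) _.
  by apply: lerD; [exact: gain_bound|exact: below_bound].
have meas (y z : R) : measurable_fun `[s, t]%classic (fun u => gain hp F y u - below z (minp (F u))).
  apply: measurable_funB; first exact: (gain_measurable hp gF).
  exact: (below_minp_measurable gF).
have clo : wI s t (lo n) @[n --> \oo] --> wI s t (net hp F x).
  apply: (@wI_cvg _ _ hp _ _ s0 _ _ 2) => [n|n u _|u _]; [exact: meas|exact: bnd|].
  by apply: cvgB; [exact: cvg_cst|exact: below_right_cvg].
have chi : wI s t (hi n) @[n --> \oo] --> wI s t (net hp F x).
  apply: (@wI_cvg _ _ hp _ _ s0 _ _ 2) => [n|n u _|u _]; [exact: meas|exact: bnd|].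
  by apply: cvgB; [exact: gain1_right_cvg|exact: cvg_cst].
apply: (squeeze_cvgr _ clo chi); apply: nearW => n.
rewrite (tent_balance _ _ as_ st tb).
have rb u : `|rate hp F (tent x n) u| <= 2.
  by apply: le_trans (rate_bound hp F u (tent_bound x n)) _; rewrite -[2]/(1 + 1).
have gainE (y u : R) : gain hp F y u = \int[mix (F u)]_(z in setT) below y (minp (F u) + z).
  by rewrite /gain /gain1 dist_Rintegral; apply: eq_Rintegral => z _; rewrite /below lerBrDl.
apply/andP; split; apply: (@le_wI _ _ hp _ _ s0 _ _ 2) => u _ //; try exact: bnd;
    rewrite /lo /hi gainE /rate; apply: lerB.
- apply: (@le_Rintegral_prob _ _ _ _ _ _ 1) => z; [exact: below_bound|exact: tent_bound|].
  exact: below_le_tent.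
- exact: tent_le_below.
- apply: (@le_Rintegral_prob _ _ _ _ _ _ 1) => z; [exact: tent_bound|exact: below_bound|].
  exact: tent_le_below.
- exact: below_le_tent.
Qed.

Lemma weak_fp : fp hp a b F.
Proof. exact: lin_fp weak_lin. Qed.

End weak_lin.

(** * Growth and continuous dependence *)

Section comparison.
Context {R : realType}.
Variables (p : nat -> R) (hp : coag_weights p).
Implicit Types (F G : R -> probability R R).
Local Notation wI := (wI p).
Local Notation W := (W p).
Local Notation gain := (gain hp).
Local Notation mix := (mixture hp).

Let Q0 := Q1_gt0 hp.

Lemma W_le_inv (s t : R) : 0 < s -> 0 < t -> W s <= W t -> s <= t.
Proof.
move=> s0 t0 st; rewrite leNgt; apply/negP => ts.
by have := W_lt hp t0 ts; lra.
Qed.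

Lemma W_shift (s d : R) : 0 < s -> exists2 r, 0 < r & W r = W s + d.
Proof.
by move=> s0; exists (s * expR (Q1 p * d)); [rewrite mulr_gt0 ?expR_gt0|rewrite W_scale].
Qed.

Section window.
Variables (a b : R) (a0 : 0 < a) (F G : R -> probability R R).
Hypotheses (fF : fp hp a b F) (fG : fp hp a b G).
Variables (x0 h : R) (x00 : 0 < x0) (h0 : 0 < h) (hx0 : h <= x0) (h2 : h <= 2^-1).
Hypotheses (xF : supp_ge x0 (F a)) (xG : supp_ge x0 (G a)).
Variable j : nat.
Hypothesis FG : forall t y, a <= t <= b -> y < j.+1%:R * x0 ->
  dist (F t) y <= dist (G t) (y + h) + h.

Let gF : good a b F. Proof. by case: fF. Qed.
Let gG : good a b G. Proof. by case: fG. Qed.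
Let sF t : a <= t <= b -> supp_ge x0 (F t).
Proof. by move=> tab; exact: (good_supp gF tab). Qed.
Let sG t : a <= t <= b -> supp_ge x0 (G t).
Proof. by move=> tab; exact: (good_supp gG tab). Qed.

Let jS : j.+2%:R * x0 = j.+1%:R * x0 + x0.
Proof. by rewrite -natr1 mulrDl mul1r. Qed.

(* A jump of the minimal size of [F] past [y] may be delayed with respect to the
   one of [G], but at most by the time needed to consume the mass [h]. *)
Lemma minp_lag u v : a <= v -> v <= u -> u <= b -> 2 * h <= W u - W v ->
  minp (F u) < j.+1%:R * x0 -> minp (G v) <= minp (F u) + h.
Proof.
move=> av vu ub Wuv lj; set l := minp (F u) in lj *.
have uab : a <= u <= b by rewrite ub (le_trans av).
have vab : a <= v <= b by rewrite av (le_trans vu).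
have Gv0 := supp_geW (ltW x00) (sG vab).
have Fu0 := supp_geW (ltW x00) (sF uab).
apply/ler_addgt0Pr => e e0.
pose y := Num.min (l + e) ((l + j.+1%:R * x0) / 2).
have ly : l < y by rewrite /y lt_min; apply/andP; split; lra.
have yj : y < j.+1%:R * x0 by rewrite /y gt_min; apply/orP; right; lra.
have yl : y <= l + e by rewrite /y ge_min lexx.
apply: (@le_trans _ _ (y + h)); last by lra.
apply: minp_le => //; rewrite lt0r dist_ge0 andbT; apply/eqP => G0.
have := FG vab yj; rewrite G0 add0r => Fvh.
have := dist_gt0 Fu0 ly.
by rewrite (fp_vanish a0 fF av vu ub Fvh h2 Wuv) ltxx.
Qed.

(** With [l] the min of [F u]: if [x < l + l] there is no gain; otherwise [l] and [x - l] both lie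
    in the window already compared. The shift is [j.+1%:R * h] from the mixtures plus one [h] from
    the mins. *)
Lemma gain_lag u v x : a <= v -> v <= u -> u <= b -> 2 * h <= W u - W v ->
  x < j.+2%:R * x0 -> gain F x u <= gain G (x + j.+2%:R * h) v + j.+1%:R * h.
Proof.
move=> av vu ub Wuv xj.
have uab : a <= u <= b by rewrite ub (le_trans av).
have vab : a <= v <= b by rewrite av (le_trans vu).
have jh0 : 0 <= j.+1%:R * h by rewrite mulr_ge0// ltW.
have Fu0 := supp_geW (ltW x00) (sF uab).
set l := minp (F u); have [xl|lx] := ltP x (l + l).
  rewrite [X in X <= _](gain1_eq0 hp (minp_ge0 Fu0) (supp_ge_minp Fu0) xl).
  by rewrite addr_ge0// gain1_ge0.
have x0l : x0 <= l by apply: minp_ge (ltW x00) (sF uab).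
have lj : l < j.+1%:R * x0.
  have : x0 <= j.+1%:R * x0 by rewrite ler_peMl ?ler1n// ltW.
  by lra.
have ml := minp_lag av vu ub Wuv lj.
have zj : x - l < j.+1%:R * x0 by lra.
have FGu y : y < j.+1%:R * x0 -> dist (F u) y <= dist (G u) (y + h) + h by exact: FG.
have hx : 0 <= h <= x0 by rewrite (ltW h0).
apply: le_trans (le_dist_mixture_window hp (sF uab) (sG uab) hx FGu zj) _.
rewrite lerD2r; apply: (@le_trans _ _ (dist (mix (G v)) (x - l + j.+1%:R * h))).
  apply: (@le_dist_mixture_below _ _ hp _ _ (x - l + j.+1%:R * h + 1)) => //.
  - exact: supp_geW (ltW x00) (sG uab).
  - exact: supp_geW (ltW x00) (sG vab).
  - by move=> y _; exact: gG.2.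
  - by rewrite ltrDl.
apply: le_dist; have -> : j.+2%:R * h = j.+1%:R * h + h by rewrite -natr1 mulrDl mul1r.
by have := ml; rewrite -/l; lra.
Qed.

Variables (D k : R) (DE : D = 2 * h) (kE : k = j.+1%:R * h).

(* Sliding back along a grid of mesh [D], since both rates are nonincreasing. *)
Lemma wI_gain_lag x y t q (i : nat) : x < j.+2%:R * x0 -> y = x + j.+2%:R * h -> a <= q -> a <= t -> t <= b ->
  W t = W q + 2 * D -> W t - W a <= (i%:R + 3) * D ->
  wI a t (gain F x) <= 3 * D + wI a q (gain G y) + (W t - W a) * k.
Proof.
move=> xj yE; have D0 : 0 < D by rewrite DE mulr_gt0.
have k0 : 0 <= k by rewrite kE mulr_ge0// ltW.
(* Within W-time [3 * D] of [a] the trivial rate bound 1 suffices. *)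
have small t' q' : a <= t' -> a <= q' -> W t' - W a <= 3 * D ->
    wI a t' (gain F x) <= 3 * D + wI a q' (gain G y) + (W t' - W a) * k.
  move=> at' aq' W3; have /andP[_ A1] := wI_gain_le_W hp F x a0 at'.
  have /andP[A2 _] := wI_gain_le_W hp G y a0 aq'.
  apply: (le_trans A1); apply: (le_trans W3); rewrite -addrA lerDl addr_ge0//.
  by rewrite mulr_ge0// subr_ge0 (W_le hp).
elim: i t q => [|i IH] t q aq at_ tb Wtq Wt; first by apply: small => //; rewrite add0r in Wt.
have [W3|W3] := leP (W t - W a) (3 * D); first exact: small.
have t0 := lt_le_trans a0 at_; have q0 := lt_le_trans a0 aq.
(* [r] and [q2] are one mesh before [t] and [q]. As [q] is two meshes before [t], the gap from [q]
   to [r] is [D = 2 * h], just what [gain_lag] asks for: the largest rate of [F] on [[r, t]] is met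
   by the smallest rate of [G] on [[q2, q]]. *)
have [r r0 Wr] := W_shift (- D) t0; have [q2 q20 Wq2] := W_shift (- D) q0.
have ar : a <= r by apply: W_le_inv => //; rewrite Wr; lra.
have rt : r <= t by apply: W_le_inv => //; rewrite Wr; lra.
have aq2 : a <= q2 by apply: W_le_inv => //; rewrite Wq2; lra.
have q2q : q2 <= q by apply: W_le_inv => //; rewrite Wq2; lra.
have qr : q <= r by apply: W_le_inv => //; rewrite Wr; lra.
have rb := le_trans rt tb; have qb := le_trans qr rb.
rewrite (wI_gain_split hp a0 gF x (lexx a) ar rt tb).
rewrite (wI_gain_split hp a0 gG y (lexx a) aq2 q2q qb).
have e1 : W t - W r = D by rewrite Wr; ring.
have e2 : W q - W q2 = D by rewrite Wq2; ring.
have e3 : (W t - W a) * k = (W r - W a) * k + D * k by rewrite -mulrDl Wr; congr (_ * _); ring.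
have e4 : W r = W q2 + 2 * D by rewrite Wr Wq2 Wtq; ring.
have WD : 2 * h <= W r - W q by rewrite -DE Wr Wtq; lra.
have Wr' : W r - W a <= (i%:R + 3) * D by move: Wt; rewrite Wr -natr1; lra.
have S1 : wI r t (gain F x) <= gain F x r * D.
  rewrite -e1; apply: (@wI_gain_le _ _ hp) r0 rt _ => u /andP[ru ut].
  exact: (gain_noninc hp gF x ar ru (le_trans ut tb)).
have S2 : gain G y q * D <= wI q2 q (gain G y).
  rewrite -e2; apply: (@wI_gain_ge _ _ hp) q20 q2q _ => u /andP[qu uq].
  exact: (gain_noninc hp gG y (le_trans aq2 qu) uq qb).
have S3 := gain_lag aq qr rb WD xj; rewrite -yE -kE in S3.
have S4 : wI a r (gain F x) <= 3 * D + wI a q2 (gain G y) + (W r - W a) * k.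
  exact: IH.
have S5 : gain F x r * D <= (gain G y q + k) * D by rewrite ler_wpM2r// ltW.
rewrite e3; move: S1 S2 S3 S4 S5.
move: (wI a r (gain F x)) (wI r t (gain F x)) (wI a q2 (gain G y))
  (wI q2 q (gain G y)) (gain F x r) (gain G y q) => A1 A2 A3 A4 A5 A6 S1 S2 S3 S4 S5.
by move: ((W r - W a) * k) S4 => A7 S4; lra.
Qed.

(** The sliding starts with [q] two meshes before [t]; the gain of [G] over [[q, t]] is nonnegative
    and can be added. If [t] is too close to [a] for that, the rate bound 1 suffices. *)
Lemma wI_gain_window x y t : x < j.+2%:R * x0 -> y = x + j.+2%:R * h -> a <= t -> t <= b ->
  wI a t (gain F x) <= 3 * D + wI a t (gain G y) + (W t - W a) * k.
Proof.
move=> xj yE at_ tb; have t0 := lt_le_trans a0 at_.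
have D0 : 0 < D by rewrite DE mulr_gt0.
have k0 : 0 <= k by rewrite kE mulr_ge0// ltW.
have Wat : 0 <= W t - W a by rewrite subr_ge0 (W_le hp).
have /andP[A0 _] := wI_gain_le_W hp G y a0 at_.
have [W2|W2] := ltP (W t - W a) (2 * D).
  have /andP[_ A1] := wI_gain_le_W hp F x a0 at_.
  apply: (le_trans A1); apply: (le_trans (ltW W2)); rewrite -addrA ler_wpDr//.
    by rewrite addr_ge0// mulr_ge0.
  by rewrite ler_wpM2r ?ler_nat// ltW.
have [q q0 Wq] := W_shift (- (2 * D)) t0.
have aq : a <= q by apply: W_le_inv => //; rewrite Wq; lra.
have qt : q <= t by apply: W_le_inv => //; rewrite Wq; lra.
pose i := Num.truncn ((W t - W a) / D).
have Wi : W t - W a <= (i%:R + 3) * D.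
  rewrite -ler_pdivrMr//; have := truncnS_gt ((W t - W a) / D).
  by rewrite -/i -natr1; lra.
have Wtq : W t = W q + 2 * D by rewrite Wq subrK.
have := wI_gain_lag xj yE aq at_ tb Wtq Wi.
rewrite (wI_gain_split hp a0 gG y (lexx a) aq qt tb).
have /andP[A1 _] := wI_gain_le_W hp G y q0 qt.
by move/le_trans; apply; rewrite lerD2r lerD2l lerDl.
Qed.

Lemma dist_window (E : R) : W b - W a <= E -> 0 <= E ->
  (forall y, y < j.+2%:R * x0 -> dist (F a) y <= dist (G a) (y + h) + h) ->
  forall t x (h' : R), a <= t <= b -> x < j.+2%:R * x0 ->
  h' = (7 + j.+2%:R + E * j.+1%:R) * h ->
  dist (F t) x <= dist (G t) (x + h') + h'.
Proof.
move=> WE E0 init t x h' /andP[at_ tb] xj ->.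
have t0 := lt_le_trans a0 at_.
pose y := x + j.+2%:R * h.
have k0 : 0 <= k by rewrite kE mulr_ge0// ltW.
have Wtb : W t <= W b by rewrite (W_le hp).
have Ek : (W t - W a) * k <= E * k.
  by rewrite ler_wpM2r// (le_trans _ WE)// lerD2r.
have ekh : E * k = E * j.+1%:R * h by rewrite kE mulrA.
have Ekh0 : 0 <= E * j.+1%:R * h by rewrite -ekh mulr_ge0.
have jh0 : 0 <= j.+2%:R * h by rewrite mulr_ge0// ltW.
have hE : (7 + j.+2%:R + E * j.+1%:R) * h = 7 * h + j.+2%:R * h + E * j.+1%:R * h by ring.
have hj : h <= j.+2%:R * h by rewrite ler_peMl ?ler1n// ltW.
apply: (@le_trans _ _ (dist (G t) y + (7 * h + E * j.+1%:R * h))); last first.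
  have h7 : 0 <= 7 * h by rewrite mulr_ge0// ltW.
  apply: lerD; last by rewrite hE; lra.
  by apply: le_dist; rewrite /y hE; lra.
have Ga : dist (G a) (x + h) <= dist (G a) y by apply: le_dist; rewrite lerD2l.
rewrite (fF.2 a t x)// (fG.2 a t y)//.
have := wI_gain_window xj (erefl y) at_ tb; have := init x xj; move: Ga Ek; rewrite ekh DE.
move: (wI a t (gain F x)) (wI a t (gain G y)) (dist (F a) x) (dist (G a) y)
  (dist (G a) (x + h)) (W t - W a) => A1 A2 A3 A4 A5 V.
move: (E * j.+1%:R * h) Ekh0 (V * k) => U U0 Vk.
set B := A4 + _ - _; set M := Num.max 0 B => Ga VU I S.
have M0 : 0 <= M by rewrite /M le_max lexx.
have MB : B <= M by rewrite /M le_max lexx orbT.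
rewrite ge_max; apply/andP; split; first by rewrite addr_ge0// addr_ge0// mulr_ge0// ltW.
by move: MB; rewrite /B; lra.
Qed.

End window.

(** [C] is a product of window constants, fixed by [j] and [E] before the solutions are given; the
    smallness conditions bear on [C * h], the error in the last window. The induction starts below
    [x0], where [F] has no mass. *)
Lemma levy_comparison (E : R) (j : nat) : 0 <= E -> exists2 C : R, 1 <= C &
  forall (a b : R) F G (x0 h : R), 0 < a -> fp hp a b F -> fp hp a b G ->
    0 < x0 -> 0 < h -> C * h <= x0 -> C * h <= 2^-1 -> W b - W a <= E ->
    supp_ge x0 (F a) -> supp_ge x0 (G a) ->
    (forall y, y < j.+1%:R * x0 -> dist (F a) y <= dist (G a) (y + h) + h) ->
    forall t x, a <= t <= b -> x < j.+1%:R * x0 ->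
      dist (F t) x <= dist (G t) (x + C * h) + C * h.
Proof.
move=> E0; elim: j => [|j [C C1 IH]].
  exists 1 => // a b F G x0 h a0 [gF _] _ x00 h0 _ _ _ xF _ _ t x tab.
  by rewrite !mul1r => xx; rewrite (good_supp gF tab xF)// addr_ge0 ?dist_ge0// ltW.
set c := 7 + j.+2%:R + E * j.+1%:R.
have c1 : 1 <= c.
  have j1 : 0 <= j.+2%:R :> R by []; have j2 : 0 <= E * j.+1%:R by rewrite mulr_ge0.
  by rewrite /c; lra.
have C0 := lt_le_trans ltr01 C1.
exists (c * C); first by rewrite mulr_ege1.
move=> a b F G x0 h a0 fF fG x00 h0 h1 h2 WE xF xG init t x tab xj.
have Ch0 : 0 < C * h by rewrite mulr_gt0.
have Cc : C * h <= c * C * h by rewrite -mulrA ler_peMl// ltW.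
have Ch1 : h <= C * h by rewrite ler_peMl// ltW.
have jj : j.+1%:R * x0 <= j.+2%:R * x0 by rewrite ler_wpM2r ?ler_nat// ltW.
have FG u y : a <= u <= b -> y < j.+1%:R * x0 ->
    dist (F u) y <= dist (G u) (y + C * h) + C * h.
  apply: (IH a b F G x0 h) => //; try lra.
  by move=> z zj; apply: init; exact: lt_le_trans jj.
apply: (@dist_window a b a0 F G fF fG x0 (C * h) x00 Ch0 _ _ xF xG j FG _ _ (erefl _) (erefl _) E WE E0) => //; try lra.
  move=> y yj; apply: le_trans (init y yj) _; apply: lerD => //.
  by apply: le_dist; rewrite lerD2l.
by rewrite mulrA.
Qed.

End comparison.

(** * From weak convergence to Levy closeness *)

Section weak_convergence.
Context {R : realType}.
Implicit Types P : probability R R.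

(** A probability has countably many atoms, whereas an interval has positive length. *)
Lemma atomless_point P (u v : R) : u < v -> exists2 x, u < x < v & P [set x] = 0%E.
Proof.
move=> uv; apply: contrapT => noatom.
pose M1 := @isMeasurableFun.Build _ _ _ _ (@idfun R) (@measurable_id _ _ setT).
pose X : {mfun R >-> R} := HB.pack (@idfun R) M1.
have cA : countable [set r | 0 < pmf (X : {RV P >-> R}) r] by exact: pmf_gt0_countable.
have : (lebesgue_measure `]u, v[%classic <=
    lebesgue_measure [set r | (0 < pmf (X : {RV P >-> R}) r)%R])%E.
  apply: le_measure; rewrite ?inE//=.
    by apply: countable_measurable => // t; exact: measurable_set1.
  move=> x; rewrite /= in_itv/= => xuv; rewrite /pmf.
  rewrite lt0r fine_ge0// andbT; apply/eqP => Px; apply: noatom; exists x => //.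
  by rewrite -[LHS]fineK ?fin_num_measure//; congr EFin.
rewrite (countable_lebesgue_measure0 cA) lebesgue_measure_itv/= lte_fin uv.
by rewrite -EFinB lee_fin; lra.
Qed.

Lemma dist_continuous P (x : R) : P [set x] = 0%E -> {for x, continuous (dist P)}.
Proof.
move=> Px; apply/cvgrPdist_lt => e e0.
have [d d0 hd] := dist_right P x e0.
have ex : fine (P `]-oo, x[%classic) = dist P x.
  congr fine; rewrite -[RHS](_ : P (`]-oo, x[ `|` [set x]) = _); last first.
    congr (P _); apply/seteqP; split => y /=; rewrite !in_itv/=.
      by case=> [/ltW//|->].
    by rewrite le_eqVlt => /predU1P[->|]; [right|left].
  rewrite measureU//; first by rewrite [X in (_ + X)%E]Px adde0.
  by apply/seteqP; split => // y []/=; rewrite in_itv/= => yx ye; rewrite ye ltxx in yx.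
have := @dist_left_cvg _ P x; rewrite ex => /cvgrPdist_lt /(_ _ e0)[n _ /(_ n (leqnn n))/= hn].
have r0 : 0 < Num.min d n.+1%:R^-1 by rewrite lt_min d0 invr_gt0 ltr0n.
apply/nbhs_ballP; exists (Num.min d n.+1%:R^-1) => //= y.
rewrite /ball/= lt_min => /andP[yd yn].
have yd' : y <= x + d by move: yd; rewrite ltr_norml => /andP[]; lra.
have yn' : x - n.+1%:R^-1 <= y.
  by move: yn; rewrite ltr_norml => /andP[_ yn]; rewrite lerBlDl -lerBlDr ltW.
have h1 := le_dist P yd'; have h2 := le_dist P yn'.
move: hn; rewrite !ltr_norml => /andP[hn1 hn2]; apply/andP; split; lra.
Qed.

(** One continuity point of the limit in each cell of length [k / 2] up to [X]: these are finitely
    many, so a single [N] serves all [y]. *)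
Lemma weak_cvg_levy (Fh : nat -> probability R R) (Fl : probability R R) (X k : R) :
  (forall n, supp_ge 0 (Fh n)) -> supp_ge 0 Fl -> weak_cvg Fh Fl -> 0 < k ->
  exists N : nat, forall n y, (N <= n)%N -> y < X ->
    dist (Fh n) y <= dist Fl (y + k) + k /\ dist Fl y <= dist (Fh n) (y + k) + k.
Proof.
move=> F0 Fl0 w k0.
have cdfE : Defs.cdf Fl = dist Fl by apply/funext => y; rewrite cdf_dist.
have /choice[c hc] : forall i : nat, exists c : R, i%:R * (k / 2) < c < i.+1%:R * (k / 2) /\
    Fl [set c] = 0%E.
  move=> i; have [c h1 h2] : exists2 c, i%:R * (k / 2) < c < i.+1%:R * (k / 2) & Fl [set c] = 0%E.
    by apply: atomless_point; rewrite ltr_pM2r ?ltr_nat// divr_gt0.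
  by exists c.
have cv i : exists N : nat, forall n, (N <= n)%N -> `|dist Fl (c i) - dist (Fh n) (c i)| < k.
  have ci : {for c i, continuous (Defs.cdf Fl)}.
    by rewrite cdfE; apply: dist_continuous; exact: (hc i).2.
  have /cvgrPdist_lt /(_ _ k0)[N _ h] := w _ ci.
  by exists N => n /h /=; rewrite !cdf_dist.
have [I XI] : exists I : nat, X <= I%:R * (k / 2).
  exists (Num.truncn (X / (k / 2))).+1; rewrite -ler_pdivrMr ?divr_gt0//.
  exact/ltW/truncnS_gt.
have [N hN] : exists N : nat, forall n i, (N <= n)%N -> (i <= I)%N ->
    `|dist Fl (c i) - dist (Fh n) (c i)| < k.
  elim: (I) => [|J [N IH]].
    by have [N h] := cv 0%N; exists N => n i Nn; rewrite leqn0 => /eqP ->; exact: h.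
  have [N' h] := cv J.+1; exists (maxn N N') => n i; rewrite geq_max => /andP[Nn N'n].
  by rewrite leq_eqVlt => /predU1P[->|]; [exact: h|rewrite ltnS; exact: IH].
exists N => n y Nn yX; have [y0|y0] := ltP y 0.
  by rewrite (F0 n y y0) (Fl0 y y0); split; rewrite addr_ge0 ?dist_ge0// ltW.
(* [y] lies in cell [i], so the continuity point of the next cell lies in [[y, y + k]]. *)
pose i := Num.truncn (y / (k / 2)).
have k20 : 0 < k / 2 by rewrite divr_gt0.
have iy : i%:R * (k / 2) <= y < i.+1%:R * (k / 2).
  have := @truncn_itv _ (y / (k / 2)); rewrite -/i divr_ge0 ?(ltW k20)// => /(_ isT).
  by rewrite ler_pdivlMr// ltr_pdivrMr.
have /andP[iy1 iy2] := iy; have [/andP[c1 c2] _] := hc i.+1.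
have iI : (i.+1 <= I)%N.
  rewrite -(ltr_nat R); move: (le_lt_trans iy1 (lt_le_trans yX XI)).
  by rewrite ltr_pM2r.
have := hN n i.+1 Nn iI; rewrite ltr_norml => /andP[h1 h2].
have cy : c i.+1 <= y + k.
  move: c2 iy1; rewrite -[i.+2%:R]natr1 -[i.+1%:R]natr1 !mulrDl; lra.
have yc : y <= c i.+1 by apply: ltW; exact: lt_trans c1.
have := le_dist Fl cy; have := le_dist (Fh n) cy.
have := le_dist Fl yc; have := le_dist (Fh n) yc; lra.
Qed.

End weak_convergence.

(** * Growth of the min *)

Section growth.
Context {R : realType}.
Variables (p : nat -> R) (hp : coag_weights p).
Local Notation W := (W p).

Lemma minp_double (t0 : R) F (n : nat) t : 0 < t0 -> (forall b, fp hp t0 b F) ->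
  t0 <= t -> n%:R <= W t - W t0 -> 2 ^+ n * minp (F t0) <= minp (F t).
Proof.
move=> t00 fF; elim: n t => [|n IH] t tt nW.
  by rewrite mul1r; exact: (good_le_minp (fF t).1).
have tpos := lt_le_trans t00 tt; have [s s0 Ws] := W_shift hp (- 1) tpos.
have n0 : 0 <= n%:R :> R by exact: ler0n.
have n1 : n.+1%:R = n%:R + 1 :> R by rewrite natr1.
have ts : t0 <= s by apply: (W_le_inv hp t00 s0); rewrite Ws; lra.
have st : s <= t by apply: (W_le_inv hp s0 tpos); rewrite Ws; lra.
have Wst : 1 <= W t - W s by rewrite Ws; lra.
apply: le_trans (fp_double t00 (fF t) ts st (lexx t) Wst).
rewrite exprS -mulrA ler_pM2l//; apply: IH => //; rewrite Ws; lra.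
Qed.

(** The number of doublings is the integer part of [W t - W t0]; rounding down costs the factor 1/2,
    and 2 to the power [W t - W t0] is the stated power of [t / t0]. *)
Lemma minp_growth (t0 : R) F t : 0 < t0 -> (forall b, fp hp t0 b F) ->
  0 < minp (F t0) -> t0 <= t ->
  2^-1 * (t / t0) `^ (ln 2 / Q1 p) <= minp (F t) / minp (F t0).
Proof.
move=> t00 fF m0 tt; have tpos := lt_le_trans t00 tt; have Q0 := Q1_gt0 hp.
have W0 : 0 <= W t - W t0 by rewrite subr_ge0 (W_le hp).
rewrite ler_pdivlMr//.
have /andP[n1 n2] := truncn_itv W0.
apply: le_trans (minp_double t00 fF tt n1).
rewrite ler_pM2r// /powR gt_eqF ?divr_gt0// (W_div hp)// mulrA divfK ?gt_eqF//.
have -> : (2 : R) ^+ Num.truncn (W t - W t0) = 2^-1 * 2 ^+ (Num.truncn (W t - W t0)).+1.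
  by rewrite exprS mulrA mulVf ?mul1r.
rewrite ler_pM2l ?invr_gt0// -[X in _ <= X ^+ _]lnK ?posrE// -expRM_natl ler_expR.
by rewrite mulrC ler_wpM2r ?ln_ge0 ?ler1n// ltW.
Qed.

End growth.

(** * Continuous dependence on the initial measure *)

Section stability.
Context {R : realType}.
Variables (p : nat -> R) (hp : coag_weights p).
Local Notation W := (W p).

Lemma weak_solution_fp (t0 : R) F b : 0 < t0 -> weak_solution p `[t0, +oo[%classic F ->
  fp hp t0 b F.
Proof.
move=> t00 wF; apply: (@weak_fp _ _ hp `[t0, +oo[%classic) => // u /andP[tu _].
by rewrite /= in_itv/= andbT.
Qed.

Lemma minp_eq_dist (P P' : probability R R) : supp_ge 0 P -> supp_ge 0 P' ->
  dist P =1 dist P' -> minp P = minp P'.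
Proof. by move=> P0 P'0 PP'; apply/eqP; rewrite eq_le !le_minp// => x; rewrite PP'. Qed.

Lemma weak_solution_stable (t0 : R) (Fh : nat -> probability R R) (Fhl : probability R R)
    (Fn : nat -> R -> probability R R) (F : R -> probability R R) : 0 < t0 ->
  (forall n, supp_ge 0 (Fh n)) -> (forall n, weak_solution p `[t0, +oo[%classic (Fn n)) ->
  (forall n, dist (Fn n t0) =1 dist (Fh n)) -> weak_cvg Fh Fhl ->
  supp_ge 0 Fhl -> 0 < minp Fhl -> weak_solution p `[t0, +oo[%classic F ->
  dist (F t0) =1 dist Fhl -> forall t, t0 < t -> weak_cvg (fun n => Fn n t) (F t).
Proof.
move=> t00 Fh0 wFn FnE wF Fl0 m0 wsF FE t tt x cx.
have fFn n b : fp hp t0 b (Fn n) := weak_solution_fp b t00 (wFn n).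
have fF b : fp hp t0 b F := weak_solution_fp b t00 wsF.
have Ft0 : supp_ge 0 (F t) by apply: (fF t).1.1; rewrite lexx ltW.
have Fnt0 n : supp_ge 0 (Fn n t) by apply: (fFn n t).1.1; rewrite lexx ltW.
have cdfE : Defs.cdf (F t) = dist (F t) by apply/funext => y; rewrite cdf_dist.
apply/cvgrPdist_le => e e0.
have e2 : 0 < e / 2 by rewrite divr_gt0.
move: cx; rewrite cdfE => /cvgrPdist_lt /(_ _ e2) /nbhs_ballP[d /= d0 hd].
set x0 := minp Fhl / 2; have x00 : 0 < x0 by rewrite divr_gt0.
have Wtt : W t0 < W t by exact: W_lt.
have E0 : 0 <= W t - W t0 by rewrite subr_ge0 ltW.
pose j := Num.truncn ((`|x| + 1) / x0).
have xj : `|x| + 1 < j.+1%:R * x0 by rewrite -ltr_pdivrMr// truncnS_gt.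
have [C C1 comp] := levy_comparison hp j E0.
have C0 := lt_le_trans ltr01 C1.
(* Bounds on [C * h]: [x0] and 1/2 for the comparison, [d / 2] for continuity of the limit at [x],
   [e / 2] for the error, [W t - W t0] to have [t1 <= t]. *)
pose h := Num.min (Num.min x0 2^-1) (Num.min (Num.min (d / 2) (e / 2)) (W t - W t0)) / C.
have h0 : 0 < h.
  by rewrite divr_gt0// !lt_min x00 e2 subr_gt0 Wtt divr_gt0// invr_gt0 ltr0n.
have Ch : C * h = Num.min (Num.min x0 2^-1) (Num.min (Num.min (d / 2) (e / 2)) (W t - W t0)).
  by rewrite /h mulrC divfK// gt_eqF.
have [Ch1 Ch2 Ch3 Ch4 Ch5] : [/\ C * h <= x0, C * h <= 2^-1, C * h <= d / 2,
    C * h <= e / 2 & C * h <= W t - W t0].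
  by rewrite Ch; split; rewrite !ge_min lexx ?orbT.
have hC : h <= C * h by rewrite ler_peMl// ltW.
(* The restarting time: W-time [h / 2] suffices to exhaust the mass [h / 4] that [Fn n t0] may have
   up to [x0], and it changes distribution functions by at most [h / 2]. *)
have [t1 t1pos Wt1] := W_shift hp (h / 2) t00.
have t01 : t0 <= t1 by apply: (W_le_inv hp) => //; rewrite Wt1; lra.
have t1t : t1 <= t by apply: (W_le_inv hp) => //; [exact: lt_trans tt|rewrite Wt1; lra].
have h4 : 0 < h / 4 by rewrite divr_gt0.
have h20 : 0 < h / 2 by rewrite divr_gt0.
have [N hN] := weak_cvg_levy (j.+1%:R * x0) Fh0 Fl0 wF h20.
(* [k <= x0 / 2] keeps [x0 + k] below the limiting min [2 * x0], so that for large [n] a mass of at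
   most [k <= h / 4] lies up to [x0]. *)
pose k := Num.min (h / 4) (x0 / 2).
have k0 : 0 < k by rewrite lt_min h4 divr_gt0.
have kh : k <= h / 4 by rewrite /k ge_min lexx.
have kx : k <= x0 / 2 by rewrite /k ge_min lexx orbT.
have [N' hN'] := weak_cvg_levy (x0 + 1) Fh0 Fl0 wF k0.
exists (maxn N N') => // n /=; rewrite geq_max => /andP[Nn N'n].
have small : dist (Fn n t0) x0 <= h / 4.
  have x1 : x0 < x0 + 1 by rewrite ltrDl.
  have [+ _] := hN' n x0 N'n x1; rewrite FnE (supp_ge_minp Fl0) ?add0r; first by move/le_trans; apply.
  by rewrite /x0 in kx x00 *; lra.
have h42 : h / 4 <= 2^-1 by lra.
have W14 : 2 * (h / 4) <= W t1 - W t0 by rewrite Wt1; lra.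
have xFn : supp_ge x0 (Fn n t1).
  move=> y yx; apply: dist_le0.
  rewrite -(fp_vanish t00 (fFn n t1) (lexx t0) t01 (lexx t1) small h42 W14).
  exact/le_dist/ltW.
have xF : supp_ge x0 (F t1).
  apply: (good_supp (fF t1).1); first by rewrite t01 lexx.
  by move=> y yx; rewrite FE (supp_ge_minp Fl0)//; rewrite /x0 in x00 yx; lra.
have sub G : (forall b, fp hp t0 b G) -> fp hp t1 t G.
  move=> fG; have [[g1 g2] eq] := fG t; split.
    split=> [u /andP[tu ut]|u v y tu]; last by apply: g2; exact: le_trans tu.
    by apply: g1; rewrite ut (le_trans t01).
  by move=> u v y tu; apply: eq; exact: le_trans tu.
(* From [t0] to [t1] the left side only decreases and the right side drops by at most [h / 2]. *)
have start (A B : R -> probability R R) : (forall b, fp hp t0 b A) -> (forall b, fp hp t0 b B) ->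
    (forall y, y < j.+1%:R * x0 -> dist (A t0) y <= dist (B t0) (y + h / 2) + h / 2) ->
    forall y, y < j.+1%:R * x0 -> dist (A t1) y <= dist (B t1) (y + h) + h.
  move=> fA fB AB y yj; have l1 := (fA t1).1.2 t0 t1 y (lexx t0) t01 (lexx t1).
  have l2 := fp_lipschitz (fB t1) (y + h / 2) (lexx t0) t01 (lexx t1).
  have /andP[l3 _] := wI_gain_le_W hp B (y + h / 2) t00 t01.
  have l4 : dist (B t1) (y + h / 2) <= dist (B t1) (y + h) by apply: le_dist; lra.
  have l5 := AB y yj; move: l2 l3; rewrite Wt1.
  move: (wI _ _ _ _) => w l2 l3; lra.
have FnF := start _ _ (fFn n) fF; have FFn := start _ _ fF (fFn n).
have ttb : t1 <= t <= t by rewrite t1t lexx.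
have WE : W t - W t1 <= W t - W t0 by rewrite lerD2l lerN2 (W_le hp).
have xxj : x < j.+1%:R * x0 by apply: le_lt_trans xj; have := ler_norm x; lra.
have xjC : x - C * h < j.+1%:R * x0 by rewrite (le_lt_trans _ xxj)// gerBl mulr_ge0// ltW.
have up : dist (Fn n t) x <= dist (F t) (x + C * h) + C * h.
  apply: (comp t1 t _ _ x0 h t1pos (sub _ (fFn n)) (sub _ fF)) => //.
  apply: FnF => y yj; have [+ _] := hN n y Nn yj; by rewrite FnE FE.
(* Taken at [x - C * h], so that the shifted argument is [x]. *)
have dn : dist (F t) (x - C * h) <= dist (Fn n t) (x - C * h + C * h) + C * h.
  apply: (comp t1 t _ _ x0 h t1pos (sub _ fF) (sub _ (fFn n))) => //.
  apply: FFn => y yj; have [_] := hN n y Nn yj; by rewrite FnE FE.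
rewrite subrK in dn.
have Ch0 : 0 < C * h by rewrite mulr_gt0.
have near (y : R) : `|x - y| <= C * h -> `|dist (F t) x - dist (F t) y| < e / 2.
  by move=> xy; apply: hd; rewrite /ball/=; apply: le_lt_trans xy _; lra.
have n1 : `|dist (F t) x - dist (F t) (x + C * h)| < e / 2.
  by apply: near; rewrite opprD addrA subrr sub0r normrN gtr0_norm.
have n2 : `|dist (F t) x - dist (F t) (x - C * h)| < e / 2.
  by apply: near; rewrite opprB addrCA subrr addr0 gtr0_norm.
rewrite !cdf_dist//; move: n1 n2; rewrite !ltr_norml ler_norml => /andP[n1 n1'] /andP[n2 n2'].
apply/andP; split; lra.
Qed.

End stability.

Theorem theorem4p4 (R : realType) (p : nat -> R) (hp : coag_weights p)
  (t0 : R) (ht0 : 0 < t0) :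
  (* (a) existence and lower bound on the min *)
  (forall Fh : probability R R, on_Rplus Fh -> 0 < minp Fh ->
     exists F : R -> probability R R,
       weak_solution p `[t0, +oo[%classic F /\
       (forall A, measurable A -> F t0 A = Fh A) /\
       (forall t, t0 <= t ->
          2^-1 * (t / t0) `^ (ln 2 / Q1 p) <= minp (F t) / minp (F t0))) /\
  (* (b) uniqueness on [t0, t1] *)
  (forall (t1 : R) (F G : R -> probability R R), t0 < t1 ->
     weak_solution p `[t0, t1]%classic F -> weak_solution p `[t0, t1]%classic G ->
     (forall A, measurable A -> F t0 A = G t0 A) ->
     forall t, t0 <= t <= t1 -> forall A, measurable A -> F t A = G t A) /\
  (* (c) continuous dependence on initial data *)
  (forall (Fh : nat -> probability R R) (Fhl : probability R R)
          (Fn : nat -> R -> probability R R) (F : R -> probability R R),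
     (forall n, on_Rplus (Fh n)) -> (forall n, 0 < minp (Fh n)) ->
     (forall n, weak_solution p `[t0, +oo[%classic (Fn n)) ->
     (forall n A, measurable A -> Fn n t0 A = Fh n A) ->
     weak_cvg Fh Fhl -> on_Rplus Fhl -> 0 < minp Fhl ->
     weak_solution p `[t0, +oo[%classic F -> (forall A, measurable A -> F t0 A = Fhl A) ->
     forall t, t0 < t -> weak_cvg (fun n => Fn n t) (F t)).

Proof.
have PT0 (P : probability R R) : on_Rplus P -> supp_ge 0 P := (on_RplusP P).1.
have J0 b : t0 <= b -> `[t0, b]%classic t0 by move=> tb; rewrite /= in_itv/= lexx.
have Jt0 : `[t0, +oo[%classic t0 by rewrite /= in_itv/= lexx.
have dist_eq (P Q : probability R R) : (forall A, measurable A -> P A = Q A) -> dist P =1 dist Q.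
  by move=> PQ x; rewrite /dist PQ.
split; [|split].
- move=> Fh /PT0 Fh0 m0.
  have [F [fF FE]] := fp_exists hp ht0 m0 (supp_ge_minp Fh0).
  have F0 : supp_ge 0 (F t0) by apply: (fF t0).1.1; rewrite lexx.
  have mF : 0 < minp (F t0) by rewrite (minp_eq_dist F0 Fh0 FE).
  exists F; split; [|split].
  + by apply: (lin_weak_solution ht0) => // b; apply: (fp_lin ht0).
  + exact: dist_inj.
  + by move=> t tt; exact: (minp_growth ht0 fF).
- move=> t1 F G t01 wF wG FG t tt.
  have fF : fp hp t0 t1 F by apply: (weak_fp hp ht0 _ wF) => u; rewrite /= in_itv.
  have fG : fp hp t0 t1 G by apply: (weak_fp hp ht0 _ wG) => u; rewrite /= in_itv.
  apply: dist_inj; apply: (fp_unique ht0 fF fG) => //; last exact: dist_eq.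
  by have [_ [_ [h _]]] := wF; apply: h; apply: J0; exact: ltW.
- move=> Fh Fhl Fn F Fh0 mFh wFn FnE wF Fl0 m0 wsF FE t tt.
  apply: (weak_solution_stable hp ht0 _ wFn _ wF _ m0 wsF) => //.
  + by move=> n; apply: PT0.
  + by move=> n; apply: dist_eq; exact: FnE.
  + exact: PT0.
  + exact: dist_eq.
Qed.
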